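(* Let $\varphi:M^m\to N^{m+1}(c)$ be a hypersurface in a space form $N^{m+1}(c)$. Let $\phi$ be the $(1,1)$-tensor field on $M$ given by $$\phi=\psi_3\,\mathrm{Id}-\psi_2A+mfA^2-A^3,$$ where $$\psi_3=\frac16m^3f^3+\frac13\operatorname{trace}A^3-\frac12mf|A|^2,\qquad \psi_2=\frac12\left(m^2f^2-|A|^2\right).$$ Then $\operatorname{div}\phi=0$.
   Context: All manifolds are connected, oriented and of dimension at least two. $N^{m+1}(c)$ is an $(m+1)$-dimensional space form of constant sectional curvature $c$ ($\mathbb{S}^{m+1}$, $\mathbb{R}^{m+1}$, $\mathbb{H}^{m+1}$ for $c=1,0,-1$). A hypersurface $\varphi:M^m\to N^{m+1}(c)$ is an isometric immersion of an $m$-dimensional Riemannian manifold $M$; $A$ is its shape operator with respect to a chosen unit normal vector field, $A^n$ is the $n$-fold composition of $A$, $f=\frac1m\operatorname{trace}A$ is the mean curvature function, and $|A|^2=\operatorname{trace}A^2$. For a symmetric $(1,1)$-tensor field $T$ on $M$, $(\nabla T)(X,Y)=\nabla_X(TY)-T(\nabla_XY)$ and $\operatorname{div}T=\operatorname{trace}(\nabla T)(\cdot,\cdot)=\sum_i(\nabla T)(E_i,E_i)$ for a local orthonormal frame $\{E_i\}$. *)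

(* Defs.v *)
(* Smooth manifolds are presented by an oriented atlas of
   charts into the row vectors 'rV[R]_n, and tensors by their components in
   each chart.  A tangent vector is a row vector v; a (1,1)-tensor is a square
   matrix T acting by v |-> v *m T, so that the powers T ^+ k of the matrix
   ring are the iterated compositions of the endomorphism. *)
From HB Require Import structures.
From mathcomp Require Import all_boot all_order all_algebra.
From mathcomp Require Import all_classical all_reals all_analysis.
Set Implicit Arguments.
Unset Strict Implicit.
Unset Printing Implicit Defensive.
Import Order.TTheory GRing.Theory Num.Theory.
Import numFieldNormedType.Exports.
Local Open Scope classical_set_scope.
Local Open Scope ring_scope.

(* Meaningful for V finite-dimensional and U open: C^(k+1) means
   differentiable with C^k directional derivatives. *)
Fixpoint Ck (R : realType) (V W : normedModType R) (k : nat) (U : set V)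
    (f : V -> W) : Prop :=
  if k is k'.+1 then
    (forall x, U x -> differentiable f x) /\
    (forall v : V, Ck k' U (fun x => 'D_v f x))
  else forall x, U x -> {for x, continuous f}.

Definition smooth_on (R : realType) (V W : normedModType R) (U : set V)
    (f : V -> W) : Prop := forall k, Ck k U f.

(* cinv is only relevant on the image of cdom under cmap. *)
Record chart (R : realType) (n : nat) (M : topologicalType) := Chart {
  cdom : set M;
  cmap : M -> 'rV[R]_n;
  cinv : 'rV[R]_n -> M;
  chart_open_dom : open cdom;
  chart_open_im : open (cmap @` cdom);
  chart_cancel : forall p, cdom p -> cinv (cmap p) = p;
  chart_cont : forall p, cdom p -> {for p, continuous cmap};
  chart_cont_inv : forall x, (cmap @` cdom) x -> {for x, continuous cinv}
}.

Definition cim (R : realType) (n : nat) (M : topologicalType)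
  (k : chart R n M) : set 'rV[R]_n := cmap k @` cdom k.

Definition transition (R : realType) (n : nat) (M : topologicalType)
  (k l : chart R n M) : 'rV[R]_n -> 'rV[R]_n := cmap l \o cinv k.

Definition tdom (R : realType) (n : nat) (M : topologicalType)
  (k l : chart R n M) : set 'rV[R]_n := cmap k @` (cdom k `&` cdom l).

Record manifold (R : realType) (n : nat) := Manifold {
  carrier :> topologicalType;
  atlas : set (chart R n carrier);
  mfd_hausdorff : hausdorff_space carrier;
  mfd_second_countable : @second_countable carrier;
  mfd_connected : connected [set: carrier];
  mfd_cover : forall p : carrier, exists2 k, atlas k & cdom k p;
  mfd_smooth : forall k l, atlas k -> atlas l ->
    smooth_on (tdom k l) (transition k l);
  mfd_oriented : forall k l, atlas k -> atlas l ->
    forall x, tdom k l x -> 0 < \det (jacobian (transition k l) x)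
}.

Definition ip (R : realType) (n : nat) (g : 'M[R]_n) (u v : 'rV[R]_n) : R :=
  (u *m g *m v^T) 0 0.

Record riemannian (R : realType) (n : nat) := Riemannian {
  mfd :> manifold R n;
  metric : chart R n mfd -> 'rV[R]_n -> 'M[R]_n;
  metric_smooth : forall k, atlas k -> smooth_on (cim k) (metric k);
  metric_sym : forall k, atlas k -> forall x, cim k x ->
    (metric k x)^T = metric k x;
  metric_pos : forall k, atlas k -> forall x, cim k x ->
    forall u, u != 0 -> 0 < ip (metric k x) u u;
  metric_change : forall k l, atlas k -> atlas l -> forall x, tdom k l x ->
    forall u v, ip (metric k x) u v =
      ip (metric l (transition k l x))
         ('D_u (transition k l) x) ('D_v (transition k l) x)
}.

(* christoffel g x i j k is the component along e_k of the Levi-Civita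
   derivative of e_j along e_i, for the coordinate frame e. *)
Definition christoffel (R : realType) (n : nat) (g : 'rV[R]_n -> 'M[R]_n)
    (x : 'rV[R]_n) (i j k : 'I_n) : R :=
  let d a b c := 'D_(delta_mx 0 a) (fun y => g y b c) x in
  2^-1 * \sum_(l < n) invmx (g x) k l * (d i j l + d j i l - d l i j).

Definition christoffel_form (R : realType) (n : nat)
    (g : 'rV[R]_n -> 'M[R]_n) (x u v : 'rV[R]_n) : 'rV[R]_n :=
  \row_k \sum_(i < n) \sum_(j < n) u 0 i * v 0 j * christoffel g x i j k.

Definition nabla (R : realType) (n : nat) (g : 'rV[R]_n -> 'M[R]_n)
    (X Y : 'rV[R]_n -> 'rV[R]_n) : 'rV[R]_n -> 'rV[R]_n :=
  fun x => 'D_(X x) Y x + christoffel_form g x (X x) (Y x).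

(* Covariant derivative at x, in the direction v, of a vector field Y along
   the map F into a coordinate domain with metric g. *)
Definition nabla_along (R : realType) (V : normedModType R) (n : nat)
    (g : 'rV[R]_n -> 'M[R]_n) (F : V -> 'rV[R]_n) (v : V)
    (Y : V -> 'rV[R]_n) (x : V) : 'rV[R]_n :=
  'D_v Y x + christoffel_form g (F x) ('D_v F x) (Y x).

(* R(u,v)w at x, computed on the extensions with constant components, whose
   Lie brackets vanish. *)
Definition curvature (R : realType) (n : nat) (g : 'rV[R]_n -> 'M[R]_n)
    (x u v w : 'rV[R]_n) : 'rV[R]_n :=
  nabla g (cst u) (nabla g (cst v) (cst w)) x -
  nabla g (cst v) (nabla g (cst u) (cst w)) x.

Definition sectional (R : realType) (n : nat) (g : 'rV[R]_n -> 'M[R]_n)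
    (x u v : 'rV[R]_n) : R :=
  ip (g x) (curvature g x u v v) u /
  (ip (g x) u u * ip (g x) v v - ip (g x) u v ^+ 2).

Definition geodesic (R : realType) (n : nat) (N : riemannian R n)
    (gamma : R -> N) : Prop :=
  continuous gamma /\
  forall l, atlas l ->
    let U := [set t | cdom l (gamma t)] in
    let u : R -> 'rV[R]_n := cmap l \o gamma in
    smooth_on U u /\
    forall t, U t -> nabla_along (metric l) u 1 (fun s => 'D_1 u s) t = 0.

Definition complete (R : realType) (n : nat) (N : riemannian R n) : Prop :=
  forall (p : N) (l : chart R n N) (v : 'rV[R]_n), atlas l -> cdom l p ->
  exists gamma : R -> N,
    [/\ geodesic gamma, gamma 0 = p & 'D_1 (cmap l \o gamma) 0 = v].

(* Simple connectedness is not required; the sphere, Euclidean space and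
   hyperbolic space are the simply connected cases. *)
Definition space_form (R : realType) (n : nat) (N : riemannian R n) (c : R)
    : Prop :=
  complete N /\
  forall l : chart R n N, atlas l -> forall x, cim l x ->
  forall u v : 'rV[R]_n, row_free (col_mx u v) ->
    sectional (metric l) x u v = c.

Definition local_map (R : realType) (m n : nat) (M : riemannian R m)
    (N : riemannian R n) (phi : M -> N) (k : chart R m M) (l : chart R n N)
    : 'rV[R]_m -> 'rV[R]_n := cmap l \o phi \o cinv k.

Definition local_dom (R : realType) (m n : nat) (M : riemannian R m)
    (N : riemannian R n) (phi : M -> N) (k : chart R m M) (l : chart R n N)
    : set 'rV[R]_m := [set x | cim k x /\ cdom l (phi (cinv k x))].

(* Positivity of the metric of M makes the differential injective. *)
Definition isometric_immersion (R : realType) (m n : nat)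
    (M : riemannian R m) (N : riemannian R n) (phi : M -> N) : Prop :=
  continuous phi /\
  forall k l, atlas k -> atlas l ->
    let F := local_map phi k l in
    smooth_on (local_dom phi k l) F /\
    forall x, local_dom phi k l x -> forall u v,
      ip (metric k x) u v = ip (metric l (F x)) ('D_u F x) ('D_v F x).

(* eta l p is the vector of components in the chart l of a tangent vector to N
   at phi p. *)
Record unit_normal (R : realType) (m n : nat) (M : riemannian R m)
    (N : riemannian R n) (phi : M -> N)
    (eta : chart R n N -> M -> 'rV[R]_n) : Prop := UnitNormal {
  normal_change : forall l l', atlas l -> atlas l' ->
    forall p, cdom l (phi p) -> cdom l' (phi p) ->
    eta l' p = 'D_(eta l p) (transition l l') (cmap l (phi p));
  normal_smooth : forall k l, atlas k -> atlas l ->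
    smooth_on (local_dom phi k l) (eta l \o cinv k);
  normal_unit : forall l, atlas l -> forall p, cdom l (phi p) ->
    ip (metric l (cmap l (phi p))) (eta l p) (eta l p) = 1;
  normal_orth : forall k l, atlas k -> atlas l ->
    forall x, local_dom phi k l x -> forall v,
    ip (metric l (local_map phi k l x)) ('D_v (local_map phi k l) x)
       (eta l (cinv k x)) = 0
}.

(* Weingarten formula: the differential of phi maps A v to minus the covariant
   derivative of eta along v. *)
Definition shape_operator (R : realType) (m n : nat) (M : riemannian R m)
    (N : riemannian R n) (phi : M -> N)
    (eta : chart R n N -> M -> 'rV[R]_n)
    (A : chart R m M -> 'rV[R]_m -> 'M[R]_m) : Prop :=
  forall k l, atlas k -> atlas l -> forall x, local_dom phi k l x ->
  forall v : 'rV[R]_m,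
    'D_(v *m A k x) (local_map phi k l) x =
    - nabla_along (metric l) (local_map phi k l) v (eta l \o cinv k) x.

Definition nablaT (R : realType) (n : nat) (g T : 'rV[R]_n -> 'M[R]_n)
    (X Y : 'rV[R]_n -> 'rV[R]_n) (x : 'rV[R]_n) : 'rV[R]_n :=
  nabla g X (fun y => Y y *m T y) x - nabla g X Y x *m T x.

Definition orthonormal_frame (R : realType) (n : nat)
    (g : 'rV[R]_n -> 'M[R]_n) (W : set 'rV[R]_n)
    (E : 'I_n -> 'rV[R]_n -> 'rV[R]_n) : Prop :=
  (forall i, smooth_on W (E i)) /\
  forall x, W x -> forall i j, ip (g x) (E i x) (E j x) = (i == j)%:R.

(* Components of the divergence of T in a coordinate domain, computed with the
   local orthonormal frame E. *)
Definition divT (R : realType) (n : nat) (g T : 'rV[R]_n -> 'M[R]_n)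
    (E : 'I_n -> 'rV[R]_n -> 'rV[R]_n) (x : 'rV[R]_n) : 'rV[R]_n :=
  \sum_(i < n) nablaT g T (E i) (E i) x.

Definition mean_curvature (R : realType) (m : nat) (A : 'M[R]_m) : R :=
  m%:R^-1 * \tr A.

Definition sqnorm (R : realType) (m : nat) (A : 'M[R]_m) : R := \tr (A ^+ 2).

Definition psi2 (R : realType) (m : nat) (A : 'M[R]_m) : R :=
  2^-1 * (m%:R ^+ 2 * mean_curvature A ^+ 2 - sqnorm A).

Definition psi3 (R : realType) (m : nat) (A : 'M[R]_m) : R :=
  6^-1 * m%:R ^+ 3 * mean_curvature A ^+ 3 + 3^-1 * \tr (A ^+ 3)
  - 2^-1 * m%:R * mean_curvature A * sqnorm A.

Definition phi_tensor (R : realType) (m : nat) (A : 'M[R]_m) : 'M[R]_m :=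
  (psi3 A)%:M - psi2 A *: A + (m%:R * mean_curvature A) *: A ^+ 2 - A ^+ 3.

(* Main.v *)
Require Import Defs.
From HB Require Import structures.
From mathcomp Require Import all_boot all_order all_algebra.
From mathcomp Require Import all_classical all_reals all_analysis.
From mathcomp Require Import ring lra.
Set Implicit Arguments.
Unset Strict Implicit.
Unset Printing Implicit Defensive.
Import Order.TTheory GRing.Theory Num.Theory.
Import numFieldNormedType.Exports.
Local Open Scope classical_set_scope.
Local Open Scope ring_scope.

(** Everything happens in one chart of M and one chart of N.  Writing points and
    tangent vectors as row vectors, the Levi-Civita connection of a metric g
    becomes a matrix conn g x u, depending linearly on u, with
    nabla_u Y = dd u Y + Y *m conn g x u, and the covariant derivative of a
    (1,1)-tensor T is cov g T x u = dd u T + [T, conn g x u].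

    The tensor phi is the third Newton transformation of the shape operator A:
    with P_0 = Id and P_(r+1) = s_(r+1) Id - P_r A, where s_r is the r-th
    elementary symmetric function of the principal curvatures, one has
    s_2 = psi2, s_3 = psi3 and phi = P_3.  Two facts about A make every P_r
    divergence free:

    - nabla_u A is self-adjoint, because A is;
    - the Codazzi equation (nabla_u A) v = (nabla_v A) u holds, because the
      curvature of a space form, applied to two tangent vectors and the normal,
      vanishes.

    Indeed div P_(r+1) is grad s_(r+1) - A (div P_r) minus the sum over i of
    (nabla_(E_i) A) (P_r E_i); this sum pairs with a vector X to
    tr (P_r nabla_X A) by Codazzi and self-adjointness (contract_codazzi), and
    this is also the derivative of s_(r+1) along X, so that the first and last
    terms cancel (newton_step).

    The Codazzi equation is obtained by differentiating the Weingarten formula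
    v A J = - nabla_v nu, where J is the Jacobian of the immersion and nu the
    normal.  Antisymmetrizing the second derivatives produces the curvature of
    N on the normal (which needs the symmetry of second derivatives, schwarz);
    the tangential part of the second derivatives of the immersion is the
    connection of M (gauss).  That sectional curvature c forces the full
    curvature tensor is the polarization argument curvature_like_eq0, applied
    to the difference of the curvature tensor of N and the model of curvature c
    (constant_curvature). *)

(** * Calculus of matrix-valued maps *)

(** The directional derivative, sealed: comparing two derivatives along
    different vectors by conversion would otherwise unfold both limits. *)
HB.lock Definition dd (R : numFieldType) (V W : normedModType R)
  (v : V) (f : V -> W) (x : V) : W := 'D_v f x.

Section Calculus.
Context {R : realType} {V : normedModType R}.
Implicit Types (x v : V).

(** The difference g - f vanishes near x, hence has differential 0 there. *)
Lemma differentiable_near_eq (W : normedModType R) (f g : V -> W) x :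
  (\near x, f x = g x) -> differentiable f x -> differentiable g x.
Proof.
move=> fg df.
suff dh : differentiable (g - f) x.
  have -> : g = (g - f) + f by rewrite subrK.
  exact: differentiableD.
set h := g - f.
have h0 : \near x, h x = 0.
  by near=> y; rewrite /h !fctE (near fg y)// subrr.
have hx0 : h x = 0 by apply: (nbhs_singleton h0).
have hE : h \o shift x = cst (h x) + (0 : V -> W) +o_ 0 id.
  apply/eqaddoP => e e0.
  have /nbhs_ballP[d /= d0 hd] := h0.
  near=> y.
  have yx : h (y + x) = 0.
    apply: hd; rewrite -ball_normE /= opprD addrCA subrr addr0 normrN.
    near: y; exact: nbhs0_lt.
  rewrite !fctE /= yx hx0 -[(0 : V -> W) y]/(0 : W) addr0.
  by rewrite !subr0 normr0 mulr_ge0// ltW.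
have c0 : continuous (0 : V -> W) by move=> y; exact: cst_continuous.
have dE : 'd h x = 0 :> (V -> W) by exact/diff_unique.
by apply/diff_locallyP; rewrite dE.
Unshelve. all: by end_near. Qed.

Lemma differentiable_mxP m n (f : V -> 'M[R]_(m, n)) x :
  differentiable f x <-> forall i j, differentiable (fun y => f y i j) x.
Proof.
split=> [df i j|df].
  apply: (@differentiable_comp _ _ _ _ f (fun N : 'M[R]_(m, n) => N i j)) => //.
  exact: differentiable_coord.
have -> : f = \sum_i \sum_j (fun y => f y i j *: delta_mx i j).
  apply/funext => y; rewrite [LHS]matrix_sum_delta fct_sumE.
  by apply: eq_bigr => i _; rewrite fct_sumE.
apply: differentiable_sum => i; apply: differentiable_sum => j.
exact: differentiableZl.
Qed.

Lemma dd_coord m n (f : V -> 'M[R]_(m, n)) x v i j :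
  differentiable f x -> dd v f x i j = dd v (fun y => f y i j) x.
Proof.
rewrite dd.unlock => df; rewrite derive_mx ?mxE//; exact: diff_derivable.
Qed.

Lemma ddE (W : normedModType R) (f : V -> W) x v : dd v f x = 'D_v f x.
Proof. by rewrite dd.unlock. Qed.

Lemma dd_cst (W : normedModType R) (a : W) x v : dd v (cst a) x = 0.
Proof. by rewrite dd.unlock derive_cst. Qed.

Lemma dd_near_eq (W : normedModType R) (f g : V -> W) x v :
  (\near x, f x = g x) -> dd v f x = dd v g x.
Proof. by rewrite dd.unlock; exact: near_eq_derive. Qed.

Lemma dd_comp (U W : normedModType R) (f : V -> U) (g : U -> W) x v :
  differentiable f x -> differentiable g (f x) ->
  dd v (fun y => g (f y)) x = dd (dd v f x) g (f x).
Proof.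
rewrite dd.unlock => df dg.
rewrite !deriveE//; last exact: differentiable_comp.
by rewrite (@diff_comp _ _ _ _ f g).
Qed.

Lemma ddDr (W : normedModType R) (f : V -> W) x u v :
  differentiable f x -> dd (u + v) f x = dd u f x + dd v f x.
Proof. by rewrite dd.unlock => df; rewrite !deriveE// linearD. Qed.

Lemma ddZr (W : normedModType R) (f : V -> W) x a v :
  differentiable f x -> dd (a *: v) f x = a *: dd v f x.
Proof. by rewrite dd.unlock => df; rewrite !deriveE// linearZ. Qed.

Lemma differentiable_bigsum (W : normedModType R) I (r : seq I) (P : pred I)
    (F : I -> V -> W) x : (forall i, P i -> differentiable (F i) x) ->
  differentiable (fun y => \sum_(i <- r | P i) F i y) x.
Proof.
move=> dF; elim: r => [|i r IH].
  by under eq_fun do rewrite big_nil; exact: differentiable_cst.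
case Pi : (P i); under eq_fun do rewrite big_cons Pi; last exact: IH.
by apply: (@differentiableD _ _ _ (F i)) => //; exact: dF.
Qed.

Lemma differentiable_bigprod I (r : seq I) (P : pred I)
    (F : I -> V -> R) x : (forall i, P i -> differentiable (F i) x) ->
  differentiable (fun y => \prod_(i <- r | P i) F i y) x.
Proof.
move=> dF; elim: r => [|i r IH].
  by under eq_fun do rewrite big_nil; exact: differentiable_cst.
case Pi : (P i); under eq_fun do rewrite big_cons Pi; last exact: IH.
by apply: (@differentiableM _ _ (F i)) => //; exact: dF.
Qed.

Lemma dd_bigsum (W : normedModType R) I (r : seq I) (P : pred I)
    (F : I -> V -> W) x v : (forall i, P i -> differentiable (F i) x) ->
  dd v (fun y => \sum_(i <- r | P i) F i y) x
    = \sum_(i <- r | P i) dd v (F i) x.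
Proof.
rewrite dd.unlock => dF; elim: r => [|i r IH].
  by under eq_fun do rewrite big_nil; rewrite big_nil derive_cst.
rewrite big_cons; case Pi : (P i); under eq_fun do rewrite big_cons Pi.
  rewrite -IH (@deriveD _ _ _ (F i))//; first exact/diff_derivable/dF.
  exact/diff_derivable/differentiable_bigsum.
exact: IH.
Qed.

Lemma differentiable_mulmx m n p (f : V -> 'M[R]_(m, n)) (g : V -> 'M[R]_(n, p))
    x : differentiable f x -> differentiable g x ->
  differentiable (fun y => f y *m g y) x.
Proof.
move=> /differentiable_mxP df /differentiable_mxP dg.
apply/differentiable_mxP => i j; under eq_fun do rewrite mxE.
apply: differentiable_bigsum => k _.
exact: (@differentiableM _ _ (fun y => f y i k)).
Qed.

Lemma dd_fM (f g : V -> R) x v :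
  differentiable f x -> differentiable g x ->
  dd v (fun y => f y * g y) x = dd v f x * g x + f x * dd v g x.
Proof.
rewrite dd.unlock => df dg.
rewrite (@deriveM _ _ f); try exact: diff_derivable.
by rewrite addrC; congr (_ + _); rewrite [LHS]mulrC.
Qed.

Lemma dd_mulmx m n p (f : V -> 'M[R]_(m, n)) (g : V -> 'M[R]_(n, p)) x v :
  differentiable f x -> differentiable g x ->
  dd v (fun y => f y *m g y) x = dd v f x *m g x + f x *m dd v g x.
Proof.
move=> df dg; have dfg := differentiable_mulmx df dg.
have /differentiable_mxP cf := df; have /differentiable_mxP cg := dg.
apply/matrixP => i j; rewrite dd_coord//.
under eq_fun do rewrite mxE.
rewrite dd_bigsum; last first.
  by move=> k _; apply: (@differentiableM _ _ (fun y => f y i k)).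
rewrite !mxE -big_split; apply: eq_bigr => k _ /=.
by rewrite !dd_coord// dd_fM.
Qed.

Lemma differentiable_trmx m n (f : V -> 'M[R]_(m, n)) x :
  differentiable f x -> differentiable (fun y => (f y)^T) x.
Proof.
move=> /differentiable_mxP df; apply/differentiable_mxP => i j.
by under eq_fun do rewrite mxE.
Qed.

Lemma dd_trmx m n (f : V -> 'M[R]_(m, n)) x v :
  differentiable f x -> dd v (fun y => (f y)^T) x = (dd v f x)^T.
Proof.
move=> df; apply/matrixP => i j; rewrite dd_coord.
  by under eq_fun do rewrite mxE; rewrite mxE dd_coord.
exact: differentiable_trmx.
Qed.

Lemma dd_fD (W : normedModType R) (f g : V -> W) x v :
  differentiable f x -> differentiable g x ->
  dd v (fun y => f y + g y) x = dd v f x + dd v g x.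
Proof.
rewrite dd.unlock => df dg.
by rewrite (@deriveD _ _ _ f)//; exact: diff_derivable.
Qed.

Lemma dd_fN (W : normedModType R) (f : V -> W) x v :
  differentiable f x -> dd v (fun y => - f y) x = - dd v f x.
Proof.
rewrite dd.unlock => df.
by rewrite (@deriveN _ _ _ f)//; exact: diff_derivable.
Qed.

Lemma differentiable_fD (W : normedModType R) (f g : V -> W) x :
  differentiable f x -> differentiable g x ->
  differentiable (fun y => f y + g y) x.
Proof. by move=> df dg; apply: (@differentiableD _ _ _ f). Qed.

Lemma differentiable_fN (W : normedModType R) (f : V -> W) x :
  differentiable f x -> differentiable (fun y => - f y) x.
Proof. by move=> df; apply: (@differentiableN _ _ _ f). Qed.

Lemma differentiable_fM (f g : V -> R) x :
  differentiable f x -> differentiable g x ->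
  differentiable (fun y => f y * g y) x.
Proof. by move=> df dg; apply: (@differentiableM _ _ f). Qed.

Lemma differentiable_scalar_mx n (f : V -> R) x :
  differentiable f x -> differentiable (fun y => (f y)%:M : 'M[R]_n) x.
Proof.
move=> df; apply/differentiable_mxP => i j; under eq_fun do rewrite mxE.
case: (i == j); first exact: df.
exact: differentiable_cst.
Qed.

Lemma dd_scalar_mx n (f : V -> R) x v :
  differentiable f x -> dd v (fun y => (f y)%:M : 'M[R]_n) x = (dd v f x)%:M.
Proof.
move=> df; apply/matrixP => i j; rewrite dd_coord.
  under eq_fun do rewrite mxE; rewrite mxE; case: (i == j) => //.
  by rewrite mulr0n dd_cst.
exact: differentiable_scalar_mx.
Qed.

Lemma differentiable_fZ m n (k : V -> R) (f : V -> 'M[R]_(m, n)) x :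
  differentiable k x -> differentiable f x ->
  differentiable (fun y => k y *: f y) x.
Proof.
move=> dk df; under eq_fun do rewrite -mul_scalar_mx.
by apply: differentiable_mulmx => //; exact: differentiable_scalar_mx.
Qed.

Lemma dd_fZ m n (k : V -> R) (f : V -> 'M[R]_(m, n)) x v :
  differentiable k x -> differentiable f x ->
  dd v (fun y => k y *: f y) x = dd v k x *: f x + k x *: dd v f x.
Proof.
move=> dk df; under eq_fun do rewrite -mul_scalar_mx.
rewrite dd_mulmx//; last exact: differentiable_scalar_mx.
by rewrite dd_scalar_mx// !mul_scalar_mx.
Qed.

Lemma differentiable_mxtrace n (f : V -> 'M[R]_n) x :
  differentiable f x -> differentiable (fun y => \tr (f y)) x.
Proof.
by move=> /differentiable_mxP df; apply: differentiable_bigsum => i _.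
Qed.

Lemma dd_mxtrace n (f : V -> 'M[R]_n) x v :
  differentiable f x -> dd v (fun y => \tr (f y)) x = \tr (dd v f x).
Proof.
move=> df; have /differentiable_mxP cf := df.
rewrite dd_bigsum//.
by apply: eq_bigr => i _; rewrite dd_coord.
Qed.

Lemma differentiable_det n (f : V -> 'M[R]_n) x :
  differentiable f x -> differentiable (fun y => \det (f y)) x.
Proof.
move=> /differentiable_mxP df.
apply: differentiable_bigsum => s _; apply: differentiable_fM.
  exact: differentiable_cst.
by apply: differentiable_bigprod => i _.
Qed.

(** By Cramer's rule the entries of the inverse are rational functions of the
    entries of f. *)
Lemma differentiable_invmx n (f : V -> 'M[R]_n) x :
  (\near x, f x \in unitmx) -> differentiable f x ->
  differentiable (fun y => invmx (f y)) x.
Proof.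
move=> fu df; have /differentiable_mxP cf := df.
apply: (@differentiable_near_eq _ (fun y => (\det (f y))^-1 *: \adj (f y))).
  by near=> y; rewrite /invmx (near fu y).
apply/differentiable_mxP => i j; under eq_fun do rewrite !mxE.
apply: differentiable_fM.
  apply: (@differentiableV _ _ (fun y => \det (f y))).
    exact: differentiable_det.
  by rewrite -unitfE -unitmxE; exact: nbhs_singleton fu.
apply: differentiable_fM; first exact: differentiable_cst.
apply: differentiable_det; apply/differentiable_mxP => k l.
by under eq_fun do rewrite !mxE.
Unshelve. all: by end_near. Qed.

Lemma dd_sum_delta n (W : normedModType R) (f : 'rV[R]_n -> W)
    (x u : 'rV[R]_n) :
  differentiable f x -> dd u f x = \sum_i u 0 i *: dd (delta_mx 0 i) f x.
Proof.
move=> df; rewrite dd.unlock deriveE// [in LHS](row_sum_delta u) linear_sum.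
by apply: eq_bigr => i _; rewrite linearZ deriveE.
Qed.

End Calculus.

(** * Symmetry of second derivatives *)

Section Schwarz.
Context {R : realType} {V : normedModType R}.
Implicit Types (x u v : V).

Lemma is_derive_line (f : V -> R) (b u : V) (s : R) :
  differentiable f (s *: u + b) ->
  is_derive s 1 (fun r => f (r *: u + b)) ('D_u f (s *: u + b)).
Proof.
move=> df.
have dl : differentiable (fun r : R => r *: u + b) s.
  apply: differentiable_fD; last exact: differentiable_cst.
  exact: (@differentiableZl _ _ _ id).
have ll : dd (1 : R) (fun r : R => r *: u + b) s = u.
  rewrite dd_fD; [|exact: (@differentiableZl _ _ _ id)|exact: differentiable_cst].
  rewrite dd_cst addr0 dd.unlock -[fun r => r *: u]/( *:%R^~ u) deriveE//.
  by rewrite diff_val scale1r.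
apply: DeriveDef.
  apply: diff_derivable.
  exact: (@differentiable_comp _ _ _ _ (fun r : R => r *: u + b) f).
by have := dd_comp (1 : R) dl df; rewrite ll dd.unlock.
Qed.

(** The second difference of f along u and v is t ^+ 2 times the derivative of
    p = D_u f along v, up to o(t ^+ 2).  The mean value theorem on
    s |-> f (s u + t v + x) - f (s u + x) expresses it as t times a difference of
    two values of p, and the differentiability of p at x estimates each. *)
Lemma second_difference (f p : V -> R) x u v :
  (\near x, differentiable f x) -> (\near x, 'D_u f x = p x) ->
  differentiable p x ->
  forall e, 0 < e -> \forall t \near 0^'+,
  `|f (t *: u + (t *: v + x)) - f (t *: u + x) - (f (t *: v + x) - f x)
     - t ^+ 2 * 'D_v p x| <= e * t ^+ 2.
Proof.
move=> df dfp dp e0 e0_gt0.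
(* The two errors in p are at most e * (t |u| + t |v|) and e * t |u|; the
   summand 1 keeps K positive when u = v = 0. *)
pose K := `|u| + `|u| + `|v| + 1.
have K0 : 0 < K by rewrite ltr_wpDl// !addr_ge0.
pose e := e0 / K.
have e_gt0 : 0 < e by rewrite divr_gt0.
have /diff_locallyP[_ /eqaddoP /(_ _ e_gt0) hd1'] := dp.
have [d1 /= d10 hd1] := (@nbhs_ballP R V 0 _).1 hd1'.
have [d2 /= d20 hd2] := (@nbhs_ballP R V x _).1 (filterI df dfp).
pose d := Num.min d1 d2.
have d_gt0 : 0 < d by rewrite lt_min d10 d20.
near=> t.
have t0 : 0 < t by near: t; exact: nbhs_right_gt.
have tK : t * K < d.
  rewrite -ltr_pdivlMr//; near: t.
  apply: nbhs_right_lt; exact: divr_gt0.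
(* b switches the summand t v on or off: the points of both segments at once. *)
have small s (b : bool) : 0 <= s <= t -> `|s *: u + b%:R *: (t *: v)| < d.
  move=> /andP[s0 st]; apply: le_lt_trans tK.
  rewrite (le_trans (ler_normD _ _))// !normrZ (ger0_norm s0) (gtr0_norm t0).
  have h1 : s * `|u| <= t * `|u| by rewrite ler_wpM2r.
  have h2 : `|b%:R : R| * (t * `|v|) <= t * `|v|.
    by case: b; rewrite ?normr1 ?mul1r// normr0 mul0r mulr_ge0// ltW.
  apply: (le_trans (lerD h1 h2)); rewrite /K.
  have : 0 <= t * `|u| by rewrite mulr_ge0// ltW.
  by nra.
have good s (b : bool) : 0 <= s <= t ->
    let y := s *: u + (b%:R *: (t *: v) + x) in
    [/\ differentiable f y, 'D_u f y = p y &
       `|p y - (p x + 'd p x (s *: u + b%:R *: (t *: v)))|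
         <= e * `|s *: u + b%:R *: (t *: v)|].
  move=> st y; have sm := small s b st.
  have [] : differentiable f y /\ 'D_u f y = p y.
    apply: hd2; rewrite -ball_normE /= /y addrA opprD addrCA subrr addr0 normrN.
    by apply: lt_le_trans sm _; rewrite ge_min lexx orbT.
  move=> dfy pfy; split => //.
  have := hd1 (s *: u + b%:R *: (t *: v)); rewrite !fctE /= /y addrA; apply.
  rewrite -ball_normE /= sub0r normrN.
  by apply: lt_le_trans sm _; rewrite ge_min lexx.
have gd s : s \in `]0, t[%R -> is_derive s 1
    (fun r => f (r *: u + (t *: v + x)) - f (r *: u + x))
    (p (s *: u + (t *: v + x)) - p (s *: u + x)).
  rewrite in_itv /= => /andP[s0 st].
  have s0t : 0 <= s <= t by rewrite !ltW.
  have [] := good s true s0t; rewrite scale1r => dA <- _.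
  have [] := good s false s0t; rewrite scale0r add0r => dB <- _.
  exact: (is_deriveB (is_derive_line dA) (is_derive_line dB)).
have gc : {within `[0, t], continuous
    (fun r => f (r *: u + (t *: v + x)) - f (r *: u + x))}.
  apply: continuous_in_subspaceT => s; rewrite inE /= in_itv /= => s0t.
  have [] := good s true s0t; rewrite scale1r => dA _ _.
  have [] := good s false s0t; rewrite scale0r add0r => dB _ _.
  apply: continuousB.
    apply: differentiable_continuous; apply/derivable1_diffP.
    by have [] := is_derive_line dA.
  apply: differentiable_continuous; apply/derivable1_diffP.
  by have [] := is_derive_line dB.
have [s] := MVT t0 gd gc.
rewrite in_itv /= => /andP[s0 st] /=; rewrite !scale0r !add0r subr0 => ->.
have s0t : 0 <= s <= t by rewrite !ltW.
have [_ _] := good s true s0t; rewrite scale1r.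
have [_ _] := good s false s0t; rewrite scale0r add0r addr0.
have -> : 'd p x (s *: u + t *: v) = s * 'D_u p x + t * 'D_v p x.
  by rewrite !deriveE// linearD !linearZ.
have -> : 'd p x (s *: u) = s * 'D_u p x by rewrite deriveE// linearZ.
have n1 : `|s *: u| <= t * `|u|.
  by rewrite normrZ (gtr0_norm s0) ler_wpM2r// ltW.
have n2 : `|s *: u + t *: v| <= t * `|u| + t * `|v|.
  by rewrite (le_trans (ler_normD _ _))// lerD// normrZ (gtr0_norm t0) lexx.
set a := p (s *: u + x); set b := p (s *: u + (t *: v + x)).
set Du := 'D_u p x; set Dv := 'D_v p x => ha hb.
have eK : e * K = e0 by rewrite /e divfK// gt_eqF.
have -> : (b - a) * t - t ^+ 2 * Dv =
   ((b - (p x + (s * Du + t * Dv))) - (a - (p x + s * Du))) * t by ring.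
rewrite normrM (gtr0_norm t0) expr2 mulrA ler_pM2r//.
rewrite (le_trans (ler_normB _ _))// (le_trans (lerD hb ha))//.
rewrite -mulrDr -eK -mulrA ler_pM2l// (le_trans (lerD n2 n1))// /K.
by lra.
Unshelve. all: by end_near. Qed.

(** The second difference is symmetric in u and v, so that both mixed
    derivatives are its limit after division by t ^+ 2. *)
Lemma schwarz_real (f p q : V -> R) x u v :
  (\near x, differentiable f x) ->
  (\near x, dd u f x = p x) -> (\near x, dd v f x = q x) ->
  differentiable p x -> differentiable q x -> dd v p x = dd u q x.
Proof.
rewrite dd.unlock => df dfp dfq dp dq.
apply/eqP; rewrite -subr_eq0 -normr_eq0 eq_le normr_ge0.
rewrite andbT; apply/ler_addgt0Pr => e e0; rewrite add0r.
have e2 : 0 < e / 2 by rewrite divr_gt0.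
have [t [/= t0 [h1 h2]]] : exists t : R, [set t | 0 < t /\
    `|f (t *: u + (t *: v + x)) - f (t *: u + x) - (f (t *: v + x) - f x)
     - t ^+ 2 * 'D_v p x| <= e / 2 * t ^+ 2 /\
    `|f (t *: v + (t *: u + x)) - f (t *: v + x) - (f (t *: u + x) - f x)
     - t ^+ 2 * 'D_u q x| <= e / 2 * t ^+ 2] t.
  apply: (@filter_ex _ (0 : R)^'+); near=> t; split.
    by near: t; exact: nbhs_right_gt.
  split; near: t; exact: second_difference.
move: h1 h2; rewrite (addrCA (t *: v) (t *: u) x) => h1 h2.
have t2 : 0 < t ^+ 2 by rewrite exprn_gt0.
rewrite -(ler_pM2r t2) -{1}(gtr0_norm t2) -normrM.
set a := f (t *: u + (t *: v + x)) in h1 h2.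
rewrite (_ : ('D_v p x - 'D_u q x) * t ^+ 2 =
 (a - f (t *: v + x) - (f (t *: u + x) - f x) - t ^+ 2 * 'D_u q x) -
 (a - f (t *: u + x) - (f (t *: v + x) - f x) - t ^+ 2 * 'D_v p x)); last by ring.
rewrite (le_trans (ler_normB _ _))// (le_trans (lerD h2 h1))//.
by lra.
Unshelve. all: by end_near. Qed.

Lemma smooth_on_differentiable (W : normedModType R) (U : set V) (f : V -> W) x :
  smooth_on U f -> U x -> differentiable f x.
Proof. by move=> /(_ 1)[df _] /df. Qed.

Lemma smooth_on_dd (W : normedModType R) (U : set V) (f : V -> W) v :
  smooth_on U f -> smooth_on U (fun y => dd v f y).
Proof. by rewrite dd.unlock => sf k; have [_ /(_ v)] := sf k.+1. Qed.

Lemma schwarz m n (U : set V) (f : V -> 'M[R]_(m, n)) x u v :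
  open U -> smooth_on U f -> U x ->
  dd v (fun y => dd u f y) x = dd u (fun y => dd v f y) x.
Proof.
move=> oU sf Ux.
have nU : \near x, U x by exact: open_nbhs_nbhs.
have d2 w : differentiable (fun y => dd w f y) x.
  exact: (smooth_on_differentiable (smooth_on_dd w sf)).
apply/matrixP => i j.
rewrite !dd_coord//.
have e w : \near x, dd w (fun y => f y i j) x = dd w f x i j.
  near=> y; rewrite dd_coord//.
  apply: smooth_on_differentiable sf _.
  by near: y.
apply: schwarz_real (e u) (e v) _ _.
- near=> y; have Uy : U y by near: y.
  by have /differentiable_mxP := smooth_on_differentiable sf Uy.
- by have /differentiable_mxP := d2 u.
- by have /differentiable_mxP := d2 v.
Unshelve. all: by end_near. Qed.

End Schwarz.

(** * The Levi-Civita connection of a metric in a chart *)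

Lemma mxDE (R : pzRingType) m n (A B : 'M[R]_(m, n)) i j :
  (A + B) i j = A i j + B i j.
Proof. by rewrite mxE. Qed.

Lemma mxNE (R : pzRingType) m n (A : 'M[R]_(m, n)) i j : (- A) i j = - A i j.
Proof. by rewrite mxE. Qed.

Lemma trmxD (R : pzRingType) m n (A B : 'M[R]_(m, n)) : (A + B)^T = A^T + B^T.
Proof. by rewrite linearD. Qed.

Lemma trmxN (R : pzRingType) m n (A : 'M[R]_(m, n)) : (- A)^T = - A^T.
Proof. by rewrite linearN. Qed.

(** Identities between sums of matrix products: products are kept as atoms, and
    the entries are compared in the ground ring. *)
Ltac mx_abel :=
  apply/matrixP => ? ?; rewrite ?(mxDE, mxNE); ring.

Section InnerProduct.
Context {R : realType} {n : nat}.
Implicit Types (M N : 'M[R]_n) (u v w : 'rV[R]_n).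

Lemma ipE M u v : ip M u v = \sum_i \sum_j u 0 i * v 0 j * M i j.
Proof.
rewrite /ip mxE exchange_big /=; apply: eq_bigr => j _.
rewrite !mxE big_distrl /=; apply: eq_bigr => i _.
by rewrite mulrAC.
Qed.

Lemma ipDl M u u' v : ip M (u + u') v = ip M u v + ip M u' v.
Proof. by rewrite /ip !mulmxDl mxE. Qed.

Lemma ipNl M u v : ip M (- u) v = - ip M u v.
Proof. by rewrite /ip !mulNmx mxE. Qed.

Lemma ipZl M a u v : ip M (a *: u) v = a * ip M u v.
Proof. by rewrite /ip -!scalemxAl mxE. Qed.

Lemma ipDr M u v v' : ip M u (v + v') = ip M u v + ip M u v'.
Proof. by rewrite /ip linearD mulmxDr mxE. Qed.

Lemma ipNr M u v : ip M u (- v) = - ip M u v.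
Proof. by rewrite /ip linearN mulmxN mxE. Qed.

Lemma ipZr M a u v : ip M u (a *: v) = a * ip M u v.
Proof. by rewrite /ip linearZ -scalemxAr mxE. Qed.

Lemma ipDm M N u v : ip (M + N) u v = ip M u v + ip N u v.
Proof. by rewrite /ip mulmxDr mulmxDl mxE. Qed.

Lemma ipT M u v : ip M^T u v = ip M v u.
Proof.
by rewrite /ip -[in RHS](trmxK (v *m M *m u^T)) [RHS]mxE !trmx_mul trmxK mulmxA.
Qed.

Lemma ip0 M u : ip M u 0 = 0.
Proof. by rewrite /ip trmx0 mulmx0 mxE. Qed.

Lemma ip_ext M N : (forall u v, ip M u v = ip N u v) -> M = N.
Proof.
move=> MN; apply/matrixP => i j.
have := MN (delta_mx 0 i) (delta_mx 0 j).
by rewrite /ip -!rowE trmx_delta -!colE !mxE.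
Qed.

End InnerProduct.

Definition metric_on (R : realType) n (U : set 'rV[R]_n)
    (g : 'rV[R]_n -> 'M[R]_n) : Prop :=
  [/\ open U, smooth_on U g, forall x, U x -> (g x)^T = g x &
     forall x, U x -> forall u, u != 0 -> 0 < ip (g x) u u].

(** The index order makes u and v enter christoffel_form g x u v as
    v *m conn g x u. *)
Definition conn (R : realType) n (g : 'rV[R]_n -> 'M[R]_n) x (u : 'rV[R]_n)
    : 'M[R]_n :=
  \matrix_(j, k) \sum_i u 0 i * christoffel g x i j k.

(** The endomorphism R(u, v) acting on row vectors on the right: products
    appear in the order opposite to that of composition. *)
Definition curv (R : realType) n (g : 'rV[R]_n -> 'M[R]_n) x (u v : 'rV[R]_n)
    : 'M[R]_n :=
  dd u (fun y => conn g y v) x + conn g x v *m conn g x u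
  - (dd v (fun y => conn g y u) x + conn g x u *m conn g x v).

Section Metric.
Context {R : realType} {n : nat} {U : set 'rV[R]_n} {g : 'rV[R]_n -> 'M[R]_n}.
Context (gU : metric_on U g).
Implicit Types (x u v w : 'rV[R]_n).

Lemma metric_near x : U x -> \near x, U x.
Proof. by have [oU _ _ _] := gU; move=> Ux; exact: open_nbhs_nbhs. Qed.

Lemma metric_diff x : U x -> differentiable g x.
Proof. by have [_ sg _ _] := gU; exact: smooth_on_differentiable. Qed.

Lemma metric_tr x : U x -> (g x)^T = g x.
Proof. by have [_ _ + _] := gU; apply. Qed.

Lemma ipC x u v : U x -> ip (g x) u v = ip (g x) v u.
Proof. by move=> Ux; rewrite -[in LHS](metric_tr Ux) ipT. Qed.

Lemma ip_eq0 x u : U x -> ip (g x) u u = 0 -> u = 0.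
Proof.
have [_ _ _ pg] := gU; move=> Ux u0; apply/eqP; apply: contraT => un0.
by have := pg x Ux u un0; rewrite u0 ltxx.
Qed.

Lemma metric_inj x u : U x -> (forall w, ip (g x) u w = 0) -> u = 0.
Proof. by move=> Ux u0; exact: ip_eq0 (u0 u). Qed.

Lemma metric_unit x : U x -> g x \in unitmx.
Proof.
move=> Ux; rewrite -row_free_unit -kermx_eq0; apply: contraT => /rowV0Pn[u].
move=> /sub_kermxP ug un0; case/negP: un0; apply/eqP/(metric_inj Ux) => w.
by rewrite /ip ug mul0mx mxE.
Qed.

Lemma christoffel_formE x u v : christoffel_form g x u v = v *m conn g x u.
Proof.
apply/rowP => k; rewrite !mxE exchange_big; apply: eq_bigr => j _ /=.
rewrite mxE big_distrr /=; apply: eq_bigr => i _.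
by rewrite mulrA (mulrC (v 0 j)).
Qed.

Lemma connD x u v : conn g x (u + v) = conn g x u + conn g x v.
Proof.
apply/matrixP => j k; rewrite !mxE -big_split; apply: eq_bigr => i _ /=.
by rewrite mxE mulrDl.
Qed.

Lemma connZ x a u : conn g x (a *: u) = a *: conn g x u.
Proof.
apply/matrixP => j k; rewrite !mxE big_distrr; apply: eq_bigr => i _ /=.
by rewrite mxE mulrA.
Qed.

Lemma derive_metric_coord x a b c : U x ->
  'D_a (fun y => g y b c) x = dd a g x b c.
Proof.
by move=> Ux; rewrite dd_coord; [rewrite dd.unlock|exact: metric_diff].
Qed.

Lemma dd_metric_sym x u : U x -> (dd u g x)^T = dd u g x.
Proof.
move=> Ux; rewrite -dd_trmx; last exact: metric_diff.
apply: dd_near_eq; near=> y; apply: metric_tr.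
by near: y; exact: metric_near.
Unshelve. all: by end_near. Qed.

(** The Koszul formula for constant vector fields, whose brackets vanish: the
    factor invmx (g x) in the Christoffel symbols is cancelled by g x. *)
Lemma koszul x u v w : U x ->
  ip (g x) (v *m conn g x u) w =
  2^-1 * (ip (dd u g x) v w + ip (dd v g x) u w - ip (dd w g x) u v).
Proof.
move=> Ux.
(* Only the values of the partial derivatives of g matter from here on. *)
have [D [coordD sumD]] : exists D : 'I_n -> 'M[R]_n,
    (forall a b c, 'D_(delta_mx 0 a) (fun y => g y b c) x = D a b c) /\
    (forall u, dd u g x = \sum_i u 0 i *: D i).
  exists (fun i => dd (delta_mx 0 i) g x); split=> [a b c|u'].
    exact: derive_metric_coord.
  exact/dd_sum_delta/metric_diff.
have low i j l : \sum_k christoffel g x i j k * g x k l =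
    2^-1 * (D i j l + D j i l - D l i j).
  rewrite /christoffel.
  under eq_bigr => k _ do under eq_bigr => q _ do rewrite !coordD.
  under eq_bigr do rewrite -mulrA big_distrl /=.
  rewrite -big_distrr /=; congr (_ * _); rewrite exchange_big /=.
  have contract q : \sum_k invmx (g x) k q * g x k l = (l == q)%:R.
    have <- : (g x *m invmx (g x)) l q = (l == q)%:R.
      by rewrite (mulmxV (metric_unit Ux)) mxE.
    rewrite mxE.
    by apply: eq_bigr => k _; rewrite mulrC; congr (_ * _);
      rewrite -[in LHS](metric_tr Ux) mxE.
  rewrite (bigD1 l) //= [X in _ + X]big1 ?addr0 => [|q ql].
    under eq_bigr => k _ do rewrite mulrAC.
    by rewrite -big_distrl /= contract eqxx mul1r.
  under eq_bigr => k _ do rewrite mulrAC.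
  by rewrite -big_distrl /= contract eq_sym (negbTE ql) mul0r.
have ->: ip (g x) (v *m conn g x u) w = \sum_i \sum_j \sum_l
    u 0 i * v 0 j * w 0 l * \sum_k christoffel g x i j k * g x k l.
  rewrite (_ : ip _ _ _ = ip (conn g x u *m g x) v w);
    last by rewrite /ip !mulmxA.
  rewrite ipE [RHS]exchange_big; apply: eq_bigr => j _ /=.
  rewrite [RHS]exchange_big; apply: eq_bigr => l _ /=.
  rewrite mxE big_distrr /=.
  under eq_bigr => k _ do rewrite mxE big_distrl big_distrr /=.
  rewrite exchange_big; apply: eq_bigr => i _ /=; rewrite big_distrr /=.
  by apply: eq_bigr => k _; ring.
have ipD a b d : ip (dd a g x) b d =
    \sum_i \sum_j \sum_k a 0 i * b 0 j * d 0 k * D i j k.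
  rewrite sumD ipE; under eq_bigr do under eq_bigr do
    rewrite summxE big_distrr /=.
  under eq_bigr do rewrite exchange_big /=.
  rewrite exchange_big; apply: eq_bigr => i _; apply: eq_bigr => j _.
  by apply: eq_bigr => k _ /=; rewrite mxE; ring.
rewrite (ipD u) (ipD v) (ipD w).
have -> : \sum_i \sum_j \sum_k v 0 i * u 0 j * w 0 k * D i j k
  = \sum_i \sum_j \sum_k u 0 i * v 0 j * w 0 k * D j i k.
  rewrite exchange_big; apply: eq_bigr => i _; apply: eq_bigr => j _.
  by apply: eq_bigr => k _; ring.
have -> : \sum_i \sum_j \sum_k w 0 i * u 0 j * v 0 k * D i j k
  = \sum_i \sum_j \sum_k u 0 i * v 0 j * w 0 k * D k i j.
  rewrite exchange_big; apply: eq_bigr => i _ /=.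
  rewrite exchange_big; apply: eq_bigr => j _ /=.
  by apply: eq_bigr => k _; ring.
rewrite -big_split -sumrB big_distrr; apply: eq_bigr => i _ /=.
rewrite -big_split -sumrB big_distrr; apply: eq_bigr => j _ /=.
rewrite -big_split -sumrB big_distrr; apply: eq_bigr => l _ /=.
by rewrite low; ring.
Qed.

(** The Koszul expression is symmetric in u and v: the torsion vanishes. *)
Lemma conn_sym x u v : U x -> v *m conn g x u = u *m conn g x v.
Proof.
move=> Ux; apply/eqP; rewrite -subr_eq0; apply/eqP/(metric_inj Ux) => w.
rewrite ipDl ipNl (koszul u v w Ux) (koszul v u w Ux).
rewrite -(ipT (dd w g x) v u) (dd_metric_sym w Ux).
move: (ip (dd u g x) v w) (ip (dd v g x) u w) (ip (dd w g x) u v) => a b d.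
by ring.
Qed.

(** The connection is metric: adding the Koszul formula for (u, v, w) and
    (u, w, v) leaves the derivative of g along u. *)
Lemma conn_compat x u : U x ->
  dd u g x = conn g x u *m g x + g x *m (conn g x u)^T.
Proof.
move=> Ux; apply: ip_ext => v w; rewrite ipDm.
rewrite (_ : ip (conn g x u *m g x) v w = ip (g x) (v *m conn g x u) w);
  last by rewrite /ip !mulmxA.
rewrite (_ : ip (g x *m _) v w = ip (g x) v (w *m conn g x u));
  last by rewrite /ip trmx_mul !mulmxA.
rewrite (ipC v _ Ux) (koszul u v w Ux) (koszul u w v Ux).
rewrite -(ipT (dd u g x) w v) (dd_metric_sym u Ux).
move: (ip (dd u g x) v w) (ip (dd v g x) u w) (ip (dd w g x) u v) => a b d.
by field.
Qed.

Lemma differentiable_dd_metric x u : U x ->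
  differentiable (fun y => dd u g y) x.
Proof.
move=> Ux; have [_ sg _ _] := gU.
exact: (smooth_on_differentiable (smooth_on_dd u sg)).
Qed.

Lemma differentiable_conn x u : U x -> differentiable (fun y => conn g y u) x.
Proof.
move=> Ux; apply/differentiable_mxP => j k; under eq_fun do rewrite mxE.
apply: differentiable_bigsum => i _.
apply: differentiable_fM; first exact: differentiable_cst.
apply: differentiable_fM; first exact: differentiable_cst.
apply: differentiable_bigsum => l _; apply: differentiable_fM.
  have : differentiable (fun y => invmx (g y)) x.
    apply: differentiable_invmx; last exact: metric_diff.
    by near=> y; apply: metric_unit; near: y; exact: metric_near.
  by move=> /differentiable_mxP.
have dd a b c : differentiable
    (fun y => 'D_(delta_mx 0 a) (fun z => g z b c) y) x.
  have /differentiable_mxP/(_ b c) := differentiable_dd_metric (delta_mx 0 a) Ux.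
  apply: differentiable_near_eq; near=> y; rewrite derive_metric_coord//.
  by near: y; exact: metric_near.
apply: differentiable_fD; first exact: differentiable_fD.
exact: differentiable_fN.
Unshelve. all: by end_near. Qed.

(** * Symmetries of the curvature and constant sectional curvature *)

Lemma curvatureE x u v w : U x -> curvature g x u v w = w *m curv g x u v.
Proof.
move=> Ux; rewrite /curvature.
have nablaE a b y : nabla g (cst a) (cst b) y = b *m conn g y a.
  by rewrite /nabla derive_cst add0r christoffel_formE.
have E a b : nabla g (cst a) (nabla g (cst b) (cst w)) x =
   w *m (dd a (fun y => conn g y b) x + conn g x b *m conn g x a).
  rewrite /nabla christoffel_formE -/(nabla g (cst b) (cst w) x) nablaE.
  under eq_fun do rewrite derive_cst add0r christoffel_formE.
  rewrite -ddE (@dd_mulmx _ _ _ _ _ (cst w)); first last.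
  - exact: differentiable_conn.
  - exact: differentiable_cst.
  by rewrite dd_cst mul0mx add0r mulmxDr mulmxA.
by rewrite !E mulmxBr.
Qed.

Lemma curv_antisym x u v : curv g x v u = - curv g x u v.
Proof. by rewrite /curv opprB. Qed.

(** Differentiating the compatibility equation once more expresses the second
    derivatives of g; their symmetry leaves only the curvature terms. *)
Lemma curv_skew x u v : U x ->
  curv g x u v *m g x + g x *m (curv g x u v)^T = 0.
Proof.
move=> Ux; have [oU sg _ _] := gU.
have E a b : dd a (fun y => dd b g y) x =
    (dd a (fun y => conn g y b) x + conn g x b *m conn g x a) *m g x
    + g x *m (dd a (fun y => conn g y b) x + conn g x b *m conn g x a)^T
    + (conn g x b *m g x *m (conn g x a)^T + conn g x a *m g x *m (conn g x b)^T).
  have dg := metric_diff Ux; have dc := differentiable_conn b Ux.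
  have dct := differentiable_trmx dc.
  transitivity (dd a (fun y => conn g y b *m g y + g y *m (conn g y b)^T) x).
    apply: dd_near_eq; near=> y; apply: conn_compat.
    by near: y; exact: metric_near.
  rewrite dd_fD; [|exact: differentiable_mulmx..].
  rewrite !dd_mulmx// dd_trmx// !conn_compat//.
  rewrite trmxD trmx_mul !mulmxDr !mulmxDl !mulmxA.
  by mx_abel.
rewrite /curv linearB /= mulmxBr mulmxBl addrACA -opprD.
apply/eqP; rewrite subr_eq0; apply/eqP.
have := schwarz v u oU sg Ux; rewrite !E.
rewrite [X in _ = _ + X -> _]addrC => /addIr //.
Unshelve. all: by end_near. Qed.

(** The first Bianchi identity: the absence of torsion, and its derivative,
    cancel the terms in pairs. *)
Lemma curv_bianchi x u v w : U x ->
  w *m curv g x u v + u *m curv g x v w + v *m curv g x w u = 0.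
Proof.
move=> Ux.
have dsym a b c :
    c *m dd a (fun y => conn g y b) x = b *m dd a (fun y => conn g y c) x.
  have E p q : dd a (fun y => p *m conn g y q) x =
      p *m dd a (fun y => conn g y q) x.
    rewrite (@dd_mulmx _ _ _ _ _ (cst p)); first last.
    - exact: differentiable_conn.
    - exact: differentiable_cst.
    by rewrite dd_cst mul0mx add0r.
  rewrite -!E; apply: dd_near_eq; near=> y; apply: conn_sym.
  by near: y; exact: metric_near.
rewrite /curv !mulmxBr !mulmxDr !mulmxA.
rewrite (dsym u v w) (dsym v w u) (dsym w u v).
rewrite (conn_sym v w Ux) (conn_sym w u Ux) (conn_sym u v Ux).
apply/rowP => i; rewrite !mxE; ring.
Unshelve. all: by end_near. Qed.

End Metric.

(** The sectional curvatures determine the curvature tensor.  The symmetries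
    imply K u v w z = K w z u v; polarizing K u v v u = 0 in u and then in v makes
    K totally antisymmetric in its first three arguments, and the Bianchi
    identity becomes 3 K = 0. *)
Lemma curvature_like_eq0 (R : realFieldType) (V : zmodType)
    (K : V -> V -> V -> V -> R) :
  (forall u u' v w z, K (u + u') v w z = K u v w z + K u' v w z) ->
  (forall u v w z, K v u w z = - K u v w z) ->
  (forall u v w z, K u v z w = - K u v w z) ->
  (forall u v w z, K u v w z + K v w u z + K w u v z = 0) ->
  (forall u v, K u v v u = 0) ->
  forall u v w z, K u v w z = 0.
Proof.
move=> add1 anti12 anti34 bianchi sec.
have pair u v w z : K u v w z = K w z u v.
  have := bianchi u v w z; have := bianchi v w z u.
  have := bianchi w z u v; have := bianchi z u v w.
  rewrite (anti12 u w v z) (anti34 v w u z) (anti34 w z u v).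
  rewrite (anti12 v z w u) (anti34 v z u w) (anti12 u z w v) (anti34 u z v w).
  by rewrite (anti34 u w v z) (anti12 u z v w) (anti34 u v w z); lra.
have add2 u v v' w z : K u (v + v') w z = K u v w z + K u v' w z.
  by rewrite !(anti12 _ u) add1; ring.
have add3 u v w w' z : K u v (w + w') z = K u v w z + K u v w' z.
  by rewrite !(pair u v) add1.
have add4 u v w z z' : K u v w (z + z') = K u v w z + K u v w z'.
  by rewrite !(pair u v) add2.
have sec1 u v z : K u v v z = 0.
  have := sec (u + z) v; rewrite add1 !add4 !sec.
  by rewrite (pair z v v u) anti12 anti34; lra.
move=> u v w z.
have skew a b d : K a b d z = - K a d b z.
  by have := sec1 a (b + d) z; rewrite add2 !add3 !sec1; lra.
have := bianchi u v w z.
by rewrite (skew v w u) (anti12 u v w) (anti12 u w v) (skew u w v); lra.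
Qed.

Section ConstantCurvature.
Context {R : realType} {n : nat} {U : set 'rV[R]_n} {g : 'rV[R]_n -> 'M[R]_n}.
Context (gU : metric_on U g) (x : 'rV[R]_n) (Ux : U x).
Implicit Types (u v w : 'rV[R]_n).
Local Notation "<< u , v >>" := (ip (g x) u v) (at level 0, u, v at level 99).

Let gram u v := <<u, u>> * <<v, v>> - <<u, v>> ^+ 2.

(** Equality case of the Cauchy-Schwarz inequality: the vector
    |u|^2 v - (u . v) u has squared norm |u|^2 gram u v. *)
Lemma gram_eq0 u v : gram u v = 0 -> u = 0 \/ exists a, v = a *: u.
Proof.
move=> G0; have [->|un0] := eqVneq u 0; [by left|right].
have uu0 : <<u, u>> != 0 by apply: contra_neq un0; exact: (ip_eq0 gU).
exists (<<u, v>> / <<u, u>>).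
suff : <<u, u>> *: v - <<u, v>> *: u = 0.
  move/eqP; rewrite subr_eq0 => /eqP/(congr1 (fun z => <<u, u>>^-1 *: z)).
  by rewrite !scalerA mulVf// scale1r mulrC.
apply: (ip_eq0 gU Ux).
rewrite ipDl ipDr ipDr !ipNl !ipNr !ipZl !ipZr (ipC gU v u Ux).
transitivity (<<u, u>> * gram u v); last by rewrite G0 mulr0.
by rewrite /gram; ring.
Qed.

Lemma gram_row_free u v : gram u v != 0 -> row_free (col_mx u v).
Proof.
move=> G0; rewrite -kermx_eq0; apply: contraT => /rowV0Pn[w /sub_kermxP].
rewrite -[w]hsubmxK mul_row_col => ab w0.
move: ab; rewrite [lsubmx w]mx11_scalar [rsubmx w]mx11_scalar !mul_scalar_mx.
set a := lsubmx w 0 0; set b := rsubmx w 0 0 => ab.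
have e1 : a * <<u, u>> + b * <<u, v>> = 0.
  by rewrite -(ipC gU v u Ux) -!ipZl -ipDl ab /ip !mul0mx mxE.
have e2 : a * <<u, v>> + b * <<v, v>> = 0.
  by rewrite -!ipZl -ipDl ab /ip !mul0mx mxE.
have a0 : a * gram u v = 0.
  rewrite /gram; transitivity (<<v, v>> * (a * <<u, u>> + b * <<u, v>>) -
    <<u, v>> * (a * <<u, v>> + b * <<v, v>>)); first by ring.
  by rewrite e1 e2; ring.
have b0 : b * gram u v = 0.
  rewrite /gram; transitivity (<<u, u>> * (a * <<u, v>> + b * <<v, v>>) -
    <<u, v>> * (a * <<u, u>> + b * <<u, v>>)); first by ring.
  by rewrite e1 e2; ring.
case/negP: w0; move/eqP: a0; rewrite mulf_eq0 (negbTE G0) orbF => /eqP a0.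
move/eqP: b0; rewrite mulf_eq0 (negbTE G0) orbF => /eqP b0.
rewrite [lsubmx w]mx11_scalar [rsubmx w]mx11_scalar -/a -/b a0 b0.
by rewrite -scalemx1 scale0r row_mx0.
Qed.

(** Polarization of the sectional curvature condition: the difference of the two
    sides has the symmetries of a curvature tensor and vanishes on (u, v, v, u),
    for dependent u and v because both terms do. *)
Lemma constant_curvature c :
  (forall u v, row_free (col_mx u v) -> sectional g x u v = c) ->
  forall u v w z, <<w *m curv g x u v, z>> =
    c * (<<v, w>> * <<u, z>> - <<u, w>> * <<v, z>>).
Proof.
move=> secc u v w z; apply/eqP; rewrite -subr_eq0; apply/eqP.
move: u v w z.
have skew a b p q : <<p *m curv g x a b, q>> = - <<q *m curv g x a b, p>>.
  have /(congr1 (fun M => ip M p q)) := curv_skew gU a b Ux.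
  rewrite ipDm {3}/ip mulmx0 mul0mx mxE.
  rewrite (_ : ip (_ *m g x) p q = <<p *m curv g x a b, q>>);
    last by rewrite /ip !mulmxA.
  rewrite (_ : ip (g x *m _) p q = <<p, q *m curv g x a b>>);
    last by rewrite /ip trmx_mul !mulmxA.
  by rewrite (ipC gU p)// => /eqP; rewrite addr_eq0 => /eqP.
have sec a b : <<b *m curv g x a b, a>> = c * gram a b.
  have [G0|G0] := eqVneq (gram a b) 0.
    rewrite G0 mulr0; case: (gram_eq0 G0) => [->|[k ->]].
      exact: ip0.
    rewrite -scalemxAl ipZl.
    have := skew a (k *: a) a a => /eqP; rewrite -addr_eq0 -mulr2n mulrn_eq0 /=.
    by move=> /eqP ->; rewrite mulr0.
  rewrite -(secc a b (gram_row_free G0)) /sectional (curvatureE gU)//.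
  by rewrite divfK.
apply: curvature_like_eq0 => [u u' v w z|u v w z|u v w z|u v w z|u v].
- have -> : curv g x (u + u') v = curv g x u v + curv g x u' v.
    rewrite /curv ddDr; last exact: (differentiable_conn gU).
    rewrite (_ : dd v (fun y => conn g y (u + u')) x =
      dd v (fun y => conn g y u) x + dd v (fun y => conn g y u') x); last first.
      rewrite -dd_fD; try exact: (differentiable_conn gU).
      by congr (dd v _ x); apply/funext => y; rewrite connD.
    rewrite !connD mulmxDl mulmxDr.
    by mx_abel.
  by rewrite mulmxDr !ipDl; ring.
- by rewrite curv_antisym mulmxN ipNl; ring.
- by rewrite skew; ring.
- have : <<w *m curv g x u v + u *m curv g x v w + v *m curv g x w u, z>> = 0.
    by rewrite (curv_bianchi gU)// /ip !mul0mx mxE.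
  rewrite !ipDl (ipC gU w v)// (ipC gU w u)// (ipC gU v u)//.
  by move=> e; rewrite -[RHS]e; ring.
- by rewrite sec /gram (ipC gU v u)//; ring.
Qed.

End ConstantCurvature.

(** * The structure equations of a hypersurface *)

(** Chain rule for the connection along a map F, evaluated on a vector field w
    along F; conn being linear in its last argument, w contributes its own
    derivative. *)
Lemma dd_conn_comp (R : realType) (V : normedModType R) n
    (O : set 'rV[R]_n) (h : 'rV[R]_n -> 'M[R]_n) (hO : metric_on O h)
    (F w : V -> 'rV[R]_n) (x u : V) :
  O (F x) -> differentiable F x -> differentiable w x ->
  differentiable (fun y => conn h (F y) (w y)) x /\
  dd u (fun y => conn h (F y) (w y)) x =
    dd (dd u F x) (fun z => conn h z (w x)) (F x) + conn h (F x) (dd u w x).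
Proof.
move=> OF dF dw.
have cE z a : conn h z a = \sum_i a 0 i *: conn h z (delta_mx 0 i).
  rewrite [in LHS](row_sum_delta a); elim/big_ind2: _ => [|p P q Q <- <-|i _].
  - by rewrite -[X in conn _ _ X](scale0r 0) connZ scale0r.
  - exact: connD.
  - exact: connZ.
have dw0 i : differentiable (fun y => w y 0 i) x.
  by have /differentiable_mxP := dw.
have dc i : differentiable (fun z => conn h z (delta_mx 0 i)) (F x).
  exact: (differentiable_conn hO).
have dcF i : differentiable (fun y => conn h (F y) (delta_mx 0 i)) x.
  exact: (@differentiable_comp _ _ _ _ F (fun z => conn h z (delta_mx 0 i))).
have dt i : differentiable
    (fun y => w y 0 i *: conn h (F y) (delta_mx 0 i)) x.
  exact: differentiable_fZ.
under eq_fun do rewrite cE; split; first exact: differentiable_bigsum.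
rewrite dd_bigsum// [in RHS](cE _ (dd u w x)).
under [in X in _ = X + _]eq_fun do rewrite cE.
rewrite dd_bigsum => [|i _]; last first.
  by apply: differentiable_fZ => //; exact: differentiable_cst.
rewrite -big_split; apply: eq_bigr => i _ /=.
rewrite dd_fZ// [RHS]addrC; congr (_ + _); first by rewrite dd_coord.
rewrite (@dd_fZ _ _ _ _ (cst (w x 0 i)))//.
by rewrite dd_cst scale0r add0r (dd_comp u dF (dc i)).
Qed.

(** Covariant derivative, in the direction u, of the (1,1)-tensor T: the
    endomorphism v |-> (nabla_u T) v, so that the two connection terms form a
    commutator. *)
Definition cov (R : realType) m (g T : 'rV[R]_m -> 'M[R]_m) (x u : 'rV[R]_m)
    : 'M[R]_m :=
  dd u T x + T x *m conn g x u - conn g x u *m T x.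

Section Hypersurface.
Context {R : realType} {m n : nat}.
Context {U : set 'rV[R]_m} {g : 'rV[R]_m -> 'M[R]_m} (gU : metric_on U g).
Context {O : set 'rV[R]_n} {h : 'rV[R]_n -> 'M[R]_n} (hO : metric_on O h).
Context {F nu : 'rV[R]_m -> 'rV[R]_n} {A : 'rV[R]_m -> 'M[R]_m}.
Context (sF : smooth_on U F) (snu : smooth_on U nu).
Context (FO : forall x, U x -> O (F x)).
Context (isoF : forall x, U x -> forall u v,
  ip (g x) u v = ip (h (F x)) (dd u F x) (dd v F x)).
Context (orth : forall x, U x -> forall v, ip (h (F x)) (dd v F x) (nu x) = 0).
Context (weingarten : forall x, U x -> forall v,
  dd (v *m A x) F x = - (dd v nu x + nu x *m conn h (F x) (dd v F x))).
Context (curv_normal : forall x, U x -> forall u v w,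
  ip (h (F x)) (nu x *m curv h (F x) (dd u F x) (dd v F x)) (dd w F x) = 0).
Implicit Types (x u v w : 'rV[R]_m).

Definition jac x : 'M[R]_(m, n) := \matrix_(i < m) dd (delta_mx 0 i) F x.

(** The pulled back connection: a vector field Y along F has covariant
    derivative dd v Y x + Y x *m pull v x along v. *)
Definition pull v x := conn h (F x) (dd v F x).

(** Second derivatives of the immersion, made covariant in the target only:
    w *m hess v x is the covariant derivative along v of dF(w), for a constant
    vector w. *)
Definition hess v x : 'M[R]_(m, n) := dd v jac x + jac x *m pull v x.

Let diffF x : U x -> differentiable F x.
Proof. exact: smooth_on_differentiable. Qed.

Let diffnu x : U x -> differentiable nu x.
Proof. exact: smooth_on_differentiable. Qed.

Let diff_ddF v x : U x -> differentiable (fun y => dd v F y) x.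
Proof. exact: (smooth_on_differentiable (smooth_on_dd v sF)). Qed.

Let diff_ddnu v x : U x -> differentiable (fun y => dd v nu y) x.
Proof. exact: (smooth_on_differentiable (smooth_on_dd v snu)). Qed.

Let near_U x : U x -> \near x, U x.
Proof. exact: (metric_near gU). Qed.

Lemma jacE x v : U x -> v *m jac x = dd v F x.
Proof.
move=> Ux; rewrite (dd_sum_delta v (diffF Ux)) mulmx_sum_row.
by apply: eq_bigr => i _; rewrite rowK.
Qed.

Lemma differentiable_jac x : U x -> differentiable jac x.
Proof.
move=> Ux; apply/differentiable_mxP => i j; under eq_fun do rewrite mxE.
by have /differentiable_mxP/(_ 0 j) := diff_ddF (delta_mx 0 i) Ux.
Qed.

Lemma dd_jac x u v : U x -> v *m dd u jac x = dd u (fun y => dd v F y) x.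
Proof.
move=> Ux; transitivity (dd u (fun y => v *m jac y) x).
  rewrite (@dd_mulmx _ _ _ _ _ (cst v)); first last.
  - exact: differentiable_jac.
  - exact: differentiable_cst.
  by rewrite dd_cst mul0mx add0r.
apply: dd_near_eq; near=> y; apply: jacE.
by near: y; exact: near_U.
Unshelve. all: by end_near. Qed.

Lemma dd_jac_sym x u v : U x -> v *m dd u jac x = u *m dd v jac x.
Proof.
move=> Ux; rewrite !dd_jac//; have [oU _ _ _] := gU.
exact: (schwarz v u oU sF Ux).
Qed.

Lemma hess_sym x u v : U x -> v *m hess u x = u *m hess v x.
Proof.
move=> Ux; rewrite !mulmxDr dd_jac_sym// !mulmxA !jacE//.
by rewrite (conn_sym hO)//; exact: FO.
Qed.

Let diff_hF x : U x -> differentiable (fun y => h (F y)) x.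
Proof.
move=> Ux; apply: (@differentiable_comp _ _ _ _ F h); first exact: diffF.
exact/(metric_diff hO)/FO.
Qed.

Lemma dd_hF x v : U x -> dd v (fun y => h (F y)) x =
  pull v x *m h (F x) + h (F x) *m (pull v x)^T.
Proof.
move=> Ux; rewrite dd_comp; [|exact: diffF|exact/(metric_diff hO)/FO].
exact/(conn_compat hO)/FO.
Qed.

Lemma isometryE x : U x -> g x = jac x *m h (F x) *m (jac x)^T.
Proof.
move=> Ux; apply: ip_ext => u v; rewrite isoF// -!jacE//.
by rewrite /ip trmx_mul !mulmxA.
Qed.

Lemma dd_induced x u : U x ->
  dd u g x = hess u x *m h (F x) *m (jac x)^T
             + (hess u x *m h (F x) *m (jac x)^T)^T.
Proof.
move=> Ux; have dJ := differentiable_jac Ux; have dJT := differentiable_trmx dJ.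
have dh := diff_hF Ux.
transitivity (dd u (fun y => jac y *m h (F y) *m (jac y)^T) x).
  apply: dd_near_eq; near=> y; apply: isometryE.
  by near: y; exact: near_U.
rewrite dd_mulmx//; last exact: differentiable_mulmx.
rewrite dd_mulmx// dd_trmx// dd_hF//.
rewrite !trmx_mul trmxK (metric_tr hO (FO Ux)) /hess trmxD trmx_mul.
rewrite !(mulmxDr, mulmxDl, mulmxA).
by mx_abel.
Unshelve. all: by end_near. Qed.

(** Gauss formula: the tangential part of hess is the connection of g.
    The tangential part is symmetric in its two arguments and recovers the
    derivative of g, so the uniqueness argument behind the Koszul formula
    identifies it. *)
Lemma gauss x u : U x ->
  hess u x *m h (F x) *m (jac x)^T = conn g x u *m g x.
Proof.
move=> Ux; pose T u := hess u x *m h (F x) *m (jac x)^T.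
have Tsym a b d : ip (T a) b d = ip (T b) a d.
  by rewrite /ip /T !mulmxA (hess_sym a b Ux).
apply: ip_ext => v w.
rewrite (_ : ip (conn g x u *m g x) v w = ip (g x) (v *m conn g x u) w);
  last by rewrite /ip !mulmxA.
rewrite (koszul gU u v w Ux) !dd_induced// !ipDm !ipT -!/(T _).
rewrite (Tsym v u) (Tsym w u v) (Tsym w v u).
move: (ip (T u) v w) (ip (T u) w v) (ip (T v) w u) => a b d.
by field.
Qed.

Lemma weingartenE x v : U x ->
  v *m A x *m jac x = - (dd v nu x + nu x *m pull v x).
Proof. by move=> Ux; rewrite jacE// weingarten. Qed.

(** The second fundamental form is the normal part of hess: differentiate the
    orthogonality of nu to the image of dF and use Weingarten's formula. *)
Lemma shape_hess x v : U x ->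
  g x *m (A x)^T *m v^T = hess v x *m h (F x) *m (nu x)^T.
Proof.
move=> Ux; have dJ := differentiable_jac Ux; have dh := diff_hF Ux.
have dn := diffnu Ux; have dnT := differentiable_trmx dn.
have : dd v (fun y => jac y *m h (F y) *m (nu y)^T) x = 0.
  rewrite -[RHS](@dd_cst _ _ _ 0 x v); apply: dd_near_eq.
  near=> y; have Uy : U y by near: y; exact: near_U.
  apply/matrixP => i j; rewrite ord1 -[RHS]/((0 : 'cV[R]_m) i 0) [RHS]mxE.
  rewrite -(orth Uy (delta_mx 0 i)) -jacE// /ip.
  by rewrite -!mulmxA -rowE [in RHS]mxE.
rewrite dd_mulmx//; last exact: differentiable_mulmx.
rewrite dd_mulmx// dd_trmx// dd_hF//.
rewrite (isometryE Ux) -!mulmxA -trmx_mul -trmx_mul mulmxA weingartenE//.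
rewrite trmxN trmxD trmx_mul /hess.
rewrite !(mulmxDr, mulmxDl, mulmxN, mulNmx, mulmxA) => e.
by apply/eqP; rewrite eq_sym -subr_eq0 -[X in _ == X]e; apply/eqP; mx_abel.
Unshelve. all: by end_near. Qed.

Lemma shape_selfadjoint x : U x -> A x *m g x = g x *m (A x)^T.
Proof.
move=> Ux; apply: ip_ext => u v; rewrite -ipT trmx_mul (metric_tr gU Ux).
rewrite /ip -!mulmxA.
rewrite (mulmxA _ _ v^T) (mulmxA _ _ u^T).
rewrite shape_hess// shape_hess//.
by rewrite !mulmxA (hess_sym u v Ux).
Qed.

(** A is only known through the Weingarten formula; solving it for A, with the
    induced metric as the invertible factor, shows that it is as regular as the
    derivatives of F and nu. *)
Lemma differentiable_shape x : U x -> differentiable A x.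
Proof.
move=> Ux.
pose N y : 'M[R]_(m, n) := \matrix_(i < m)
  (dd (delta_mx 0 i) nu y + nu y *m pull (delta_mx 0 i) y).
have dpull v : differentiable (pull v) x.
  by have [] := dd_conn_comp hO 0 (FO Ux) (diffF Ux) (diff_ddF v Ux).
have dN : differentiable N x.
  apply/differentiable_mxP => i j; under eq_fun do rewrite mxE.
  have : differentiable (fun y => dd (delta_mx 0 i) nu y
      + nu y *m pull (delta_mx 0 i) y) x.
    apply: differentiable_fD; first exact: diff_ddnu.
    by apply: differentiable_mulmx => //; exact: diffnu.
  by move=> /differentiable_mxP/(_ 0 j).
apply: (@differentiable_near_eq _ _ _
  (fun y => - (N y *m h (F y) *m (jac y)^T) *m invmx (g y))).
  near=> y; have Uy : U y by near: y; exact: near_U.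
  have -> : N y = - (A y *m jac y).
    apply/row_matrixP => i; rewrite rowK linearN /= row_mul rowE weingartenE//.
    by rewrite opprK.
  rewrite !mulNmx opprK -2!(mulmxA (A y)) -(isometryE Uy).
  by rewrite mulmxK//; exact: (metric_unit gU).
apply: differentiable_mulmx.
  apply: differentiable_fN; apply: differentiable_mulmx.
    by apply: differentiable_mulmx => //; exact: diff_hF.
  exact/differentiable_trmx/differentiable_jac.
apply: differentiable_invmx; last exact: (metric_diff gU).
by near=> y; apply: (metric_unit gU); near: y; exact: near_U.
Unshelve. all: by end_near. Qed.

(** Apply nabla_u to the Weingarten formula along v and antisymmetrize.  The
    second derivatives of F and nu cancel, leaving the curvature of h on the
    normal, whose tangential part vanishes; projecting with h J^T turns
    hess into the connection of g. *)
Lemma codazzi x u v : U x -> v *m cov g A x u = u *m cov g A x v.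
Proof.
move=> Ux; have FOx := FO Ux.
have dA := differentiable_shape Ux; have dJ := differentiable_jac Ux.
(* nabla_a applied to both sides of the Weingarten formula along b; the middle
   group is symmetric in a and b. *)
have key a b : b *m dd a A x *m jac x + b *m A x *m hess a x =
   - (dd a (fun y => dd b nu y) x
     + (dd a nu x *m pull b x + dd b nu x *m pull a x)
     + nu x *m (dd (dd a F x) (fun z => conn h z (dd b F x)) (F x)
                + pull b x *m pull a x)
     + nu x *m conn h (F x) (b *m dd a jac x)).
  have dbA : differentiable (fun y => b *m A y) x.
    by apply: differentiable_mulmx => //; exact: differentiable_cst.
  have [dp ddp] := dd_conn_comp hO a FOx (diffF Ux) (diff_ddF b Ux).
  have dnp := differentiable_mulmx (diffnu Ux) dp.
  have : dd a (fun y => b *m A y *m jac y) x =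
         dd a (fun y => - (dd b nu y + nu y *m pull b y)) x.
    apply: dd_near_eq; near=> y; apply: weingartenE.
    by near: y; exact: near_U.
  rewrite dd_mulmx// (@dd_mulmx _ _ _ _ _ (cst b))//.
  rewrite dd_cst mul0mx add0r dd_fN; last first.
    by apply: differentiable_fD => //; exact: diff_ddnu.
  rewrite dd_fD//; last exact: diff_ddnu.
  rewrite (dd_mulmx _ (diffnu Ux) dp) ddp -dd_jac// => e.
  rewrite mulmxDr addrA e mulmxA weingartenE// mulNmx mulmxDl !mulmxDr !mulmxA.
  by rewrite /pull; mx_abel.
have curvN :
  nu x *m curv h (F x) (dd u F x) (dd v F x) *m h (F x) *m (jac x)^T = 0.
  apply/rowP => i; rewrite [RHS]mxE.
  rewrite -[RHS](curv_normal Ux u v (delta_mx 0 i)) /ip.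
  rewrite -(jacE (delta_mx 0 i) Ux) trmx_mul !mulmxA.
  by rewrite trmx_delta -colE [RHS]mxE.
have : v *m dd u A x *m jac x + v *m A x *m hess u x
  - (u *m dd v A x *m jac x + u *m A x *m hess v x)
  = - (nu x *m curv h (F x) (dd u F x) (dd v F x)).
  rewrite !key (dd_jac_sym u v Ux).
  have [oU _ _ _] := gU; rewrite (schwarz u v oU snu Ux).
  rewrite /curv /pull mulmxBr !mulmxDr.
  by mx_abel.
move=> /(congr1 (fun M => M *m h (F x) *m (jac x)^T)).
rewrite !mulNmx curvN oppr0 !(mulmxDl, mulNmx).
have tang (b : 'rV[R]_m) B :
    b *m B *m jac x *m h (F x) *m (jac x)^T = b *m B *m g x.
  by rewrite (isometryE Ux) !mulmxA.
have tang2 (b : 'rV[R]_m) a : b *m hess a x *m h (F x) *m (jac x)^T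
    = b *m conn g x a *m g x.
  by rewrite -!mulmxA; congr (_ *m _); rewrite mulmxA gauss.
rewrite !tang !tang2 -!mulmxDl -mulNmx -mulmxDl.
move=> /(congr1 (mulmx^~ (invmx (g x)))).
rewrite mul0mx mulmxK ?(metric_unit gU)// => e.
apply/eqP; rewrite -subr_eq0 -[X in _ == X]e; apply/eqP.
rewrite /cov !mulmxBr !mulmxDr !mulmxA (conn_sym gU u v Ux).
by mx_abel.
Unshelve. all: by end_near. Qed.

(** Differentiate the self-adjointness of A; the metric is parallel. *)
Lemma cov_selfadjoint x u : U x ->
  cov g A x u *m g x = g x *m (cov g A x u)^T.
Proof.
move=> Ux; have dA := differentiable_shape Ux; have dAT := differentiable_trmx dA.
have dg := metric_diff gU Ux; have sA := shape_selfadjoint Ux.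
have : dd u (fun y => A y *m g y) x = dd u (fun y => g y *m (A y)^T) x.
  apply: dd_near_eq; near=> y; apply: shape_selfadjoint.
  by near: y; exact: near_U.
rewrite !dd_mulmx// dd_trmx// (conn_compat gU u Ux).
rewrite /cov !trmxD trmxN !trmx_mul.
rewrite !(mulmxDl, mulmxDr, mulmxN, mulNmx) !mulmxA.
have -> : conn g x u *m A x *m g x = conn g x u *m g x *m (A x)^T.
  by rewrite -mulmxA sA mulmxA.
rewrite sA => e.
apply/eqP; rewrite -subr_eq0; apply/eqP; move/eqP: e; rewrite -subr_eq0 => /eqP e.
by rewrite -[RHS]e; mx_abel.
Unshelve. all: by end_near. Qed.

End Hypersurface.

(** * Divergence of the Newton transformations *)

Lemma mxtraceB (R : pzRingType) n (A B : 'M[R]_n) : \tr (A - B) = \tr A - \tr B.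
Proof. by rewrite linearB. Qed.

Section CovariantDerivative.
Context {R : realType} {m : nat}.
Context {g : 'rV[R]_m -> 'M[R]_m} {x : 'rV[R]_m}.
Implicit Types (u v : 'rV[R]_m) (S T : 'rV[R]_m -> 'M[R]_m).

Lemma cov_mul S T u : differentiable S x -> differentiable T x ->
  cov g (fun y => S y *m T y) x u = cov g S x u *m T x + S x *m cov g T x u.
Proof.
move=> dS dT; rewrite /cov dd_mulmx//.
by rewrite !(mulmxDl, mulmxDr, mulmxN, mulNmx, mulmxA); mx_abel.
Qed.

Lemma cov_sub S T u : differentiable S x -> differentiable T x ->
  cov g (fun y => S y - T y) x u = cov g S x u - cov g T x u.
Proof.
move=> dS dT; rewrite /cov dd_fD//; last exact: differentiable_fN.
by rewrite dd_fN// !(mulmxDl, mulmxDr, mulmxN, mulNmx); mx_abel.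
Qed.

Lemma cov_scalar (s : 'rV[R]_m -> R) u : differentiable s x ->
  cov g (fun y => (s y)%:M) x u = (dd u s x)%:M.
Proof.
move=> ds; rewrite /cov dd_scalar_mx//.
by rewrite mul_scalar_mx mul_mx_scalar addrK.
Qed.

(** The commutator of T and the connection has no trace against a matrix that
    commutes with T, so that traces of powers are differentiated as functions. *)
Lemma trace_cov B T u : B *m T x = T x *m B ->
  \tr (B *m cov g T x u) = \tr (B *m dd u T x).
Proof.
move=> BT; rewrite /cov mulmxBr mulmxDr mxtraceB mxtraceD !mulmxA BT.
by rewrite (mxtrace_mulC (B *m conn g x u)) mulmxA addrK.
Qed.

Lemma nablaTE T (X Y : 'rV[R]_m -> 'rV[R]_m) :
  differentiable T x -> differentiable Y x ->
  nablaT g T X Y x = Y x *m cov g T x (X x).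
Proof.
move=> dT dY; rewrite /nablaT /nabla !christoffel_formE -!ddE dd_mulmx//.
rewrite /cov !(mulmxDl, mulmxDr, mulmxN, mulNmx, mulmxA); mx_abel.
Qed.

End CovariantDerivative.

Section Newton.
Context {R : realType} {m : nat}.
Context {U : set 'rV[R]_m} {g : 'rV[R]_m -> 'M[R]_m} (gU : metric_on U g).
Context {x : 'rV[R]_m} (Ux : U x).
Context {A : 'rV[R]_m -> 'M[R]_m} (dA : differentiable A x).
Context (covA_codazzi : forall u v, v *m cov g A x u = u *m cov g A x v).
Context (covA_selfadjoint : forall u,
  cov g A x u *m g x = g x *m (cov g A x u)^T).
Context {e : 'I_m -> 'rV[R]_m}
  (e_orth : forall i j, ip (g x) (e i) (e j) = (i == j)%:R).
Implicit Types (u v : 'rV[R]_m) (T : 'rV[R]_m -> 'M[R]_m).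

Definition frame_div T := \sum_i e i *m cov g T x (e i).

(* The frame as a matrix with rows e i; orthonormality says fr g fr^T = 1, and
   the inverse of a square matrix is two-sided. *)
Let fr : 'M[R]_m := \matrix_(i < m) e i.

Let frK : g x *m fr^T *m fr = 1%:M.
Proof.
have entry i j : (fr *m g x *m fr^T) i j = ip (g x) (e i) (e j).
  rewrite /ip -(rowK e i) -(rowK e j) -/fr -row_mul -[row i _ *m _]row_mul.
  by rewrite !mxE; apply: eq_bigr => k _; rewrite !mxE.
apply: mulmx1C; apply/matrixP => i j.
by rewrite mulmxA entry e_orth mxE.
Qed.

Lemma frame_expand v : v = \sum_i ip (g x) v (e i) *: e i.
Proof.
rewrite -[LHS]mulmx1 -frK !mulmxA mulmx_sum_row.
apply: eq_bigr => i _; rewrite rowK; congr (_ *: _).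
rewrite /ip [LHS]mxE [RHS]mxE; apply: eq_bigr => j _; congr (_ * _).
by rewrite !mxE.
Qed.

Lemma frame_trace (Q : 'M[R]_m) : \tr Q = \sum_i ip (g x) (e i *m Q) (e i).
Proof.
rewrite -[Q in LHS]mulmx1 -frK !mulmxA mxtrace_mulC !mulmxA.
apply: eq_bigr => i _; rewrite /ip [LHS]mxE [RHS]mxE.
apply: eq_bigr => j _; congr (_ * _); last by rewrite !mxE.
rewrite -(rowK e i) -!row_mul -/fr.
by rewrite [RHS]mxE.
Qed.

Lemma ip_suml (f : 'I_m -> 'rV[R]_m) v :
  ip (g x) (\sum_i f i) v = \sum_i ip (g x) (f i) v.
Proof. by rewrite /ip !mulmx_suml summxE. Qed.

(** Self-adjointness moves nabla_(e i) A onto v, the Codazzi equation exchanges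
    v and e i, and self-adjointness moves the result back: a trace remains. *)
Lemma contract_codazzi (P : 'M[R]_m) v :
  ip (g x) (\sum_i e i *m (P *m cov g A x (e i))) v = \tr (P *m cov g A x v).
Proof.
rewrite ip_suml frame_trace; apply: eq_bigr => i _.
set p := e i *m P.
rewrite !mulmxA -/p.
rewrite /ip -(mulmxA p) covA_selfadjoint -!mulmxA -trmx_mul covA_codazzi.
by rewrite trmx_mul !mulmxA -(mulmxA p (g x)) -covA_selfadjoint !mulmxA.
Qed.

(** One step of the Newton recursion P_(r+1) = s_(r+1) Id - P_r A: the gradient
    of s cancels the contraction of T with nabla A. *)
Lemma newton_step T (s : 'rV[R]_m -> R) :
  differentiable T x -> differentiable s x ->
  (forall u, dd u s x = \tr (T x *m cov g A x u)) ->
  frame_div T = 0 -> frame_div (fun y => (s y)%:M - T y *m A y) = 0.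
Proof.
move=> dT ds ddsE divT0.
have dTA : differentiable (fun y => T y *m A y) x by exact: differentiable_mulmx.
have dsM : differentiable (fun y => (s y)%:M : 'M[R]_m) x.
  exact: differentiable_scalar_mx.
have -> : frame_div (fun y => (s y)%:M - T y *m A y) =
   \sum_i dd (e i) s x *: e i - frame_div T *m A x
     - \sum_i e i *m (T x *m cov g A x (e i)).
  rewrite /frame_div mulmx_suml -!sumrB; apply: eq_bigr => i _.
  rewrite cov_sub// cov_scalar// cov_mul// mulmxBr mul_mx_scalar mulmxDr !mulmxA.
  by mx_abel.
rewrite divT0 mul0mx subr0; apply: (metric_inj gU Ux) => v.
have dd_sum (f : 'I_m -> 'rV[R]_m) : dd (\sum_i f i) s x = \sum_i dd (f i) s x.
  by rewrite ddE deriveE// linear_sum; apply: eq_bigr => i _; rewrite ddE deriveE.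
rewrite ipDl ipNl contract_codazzi -ddsE.
rewrite ip_suml [in X in _ - X](frame_expand v) dd_sum.
rewrite -sumrB big1// => i _.
by rewrite ipZl ddZr// (ipC gU v)// mulrC subrr.
Qed.

End Newton.

Section Phi.
Context {R : realType} {m : nat} (m0 : (0 < m)%N).

Lemma mean_curvatureE (A : 'M[R]_m) : m%:R * mean_curvature A = \tr A.
Proof. by rewrite /mean_curvature mulVKf// pnatr_eq0 -lt0n. Qed.

Lemma psi2E (A : 'M[R]_m) :
  psi2 A = 2^-1 * (\tr A * \tr A - \tr (A *m A)).
Proof. by rewrite /psi2 -exprMn mean_curvatureE expr2. Qed.

Lemma psi3E (A : 'M[R]_m) :
  psi3 A = 6^-1 * (\tr A * (\tr A * \tr A)) + 3^-1 * \tr (A *m (A *m A))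
           - 2^-1 * (\tr A * \tr (A *m A)).
Proof.
rewrite /psi3 /sqnorm -(mean_curvatureE A) [A ^+ 3]exprS [A ^+ 2]expr2 -!mulmxE.
by ring.
Qed.

(** phi as the third Newton transformation, the recursion being unrolled from
    P_0 = 1%:M. *)
Lemma phi_tensorE (A : 'M[R]_m) : phi_tensor A =
  (psi3 A)%:M - ((psi2 A)%:M - ((\tr A)%:M - 1%:M *m A) *m A) *m A.
Proof.
rewrite /phi_tensor mean_curvatureE mul1mx !(mulmxBl, mul_scalar_mx) -!scalemxAl.
by rewrite [A ^+ 3]exprSr [A ^+ 2]expr2 -!mulmxE; mx_abel.
Qed.

End Phi.

Section NewtonTensor.
Context {R : realType} {m : nat} (m0 : (0 < m)%N).
Context {U : set 'rV[R]_m} {g : 'rV[R]_m -> 'M[R]_m} (gU : metric_on U g).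
Context {x : 'rV[R]_m} (Ux : U x).
Context {A : 'rV[R]_m -> 'M[R]_m} (dA : differentiable A x).
Context (covA_codazzi : forall u v, v *m cov g A x u = u *m cov g A x v).
Context (covA_selfadjoint : forall u,
  cov g A x u *m g x = g x *m (cov g A x u)^T).
Context {e : 'I_m -> 'rV[R]_m}
  (e_orth : forall i j, ip (g x) (e i) (e j) = (i == j)%:R).
Implicit Types (u v : 'rV[R]_m).

Let tr1 y := \tr (A y).
Let tr2 y := \tr (A y *m A y).
Let tr3 y := \tr (A y *m (A y *m A y)).

Let d1 : differentiable tr1 x. Proof. exact: differentiable_mxtrace. Qed.
Let dAA : differentiable (fun y => A y *m A y) x.
Proof. exact: differentiable_mulmx. Qed.
Let d2 : differentiable tr2 x. Proof. exact: differentiable_mxtrace. Qed.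
Let d3 : differentiable tr3 x.
Proof. exact/differentiable_mxtrace/differentiable_mulmx. Qed.

Let dtr1 u : dd u tr1 x = \tr (cov g A x u).
Proof.
rewrite dd_mxtrace// -[cov _ _ _ _]mul1mx trace_cov ?mul1mx//.
by rewrite mulmx1.
Qed.

Let dtr2 u : dd u tr2 x = 2 * \tr (A x *m cov g A x u).
Proof.
rewrite dd_mxtrace// dd_mulmx// mxtraceD mxtrace_mulC trace_cov//.
by ring.
Qed.

Let dtr3 u : dd u tr3 x = 3 * \tr (A x *m A x *m cov g A x u).
Proof.
rewrite dd_mxtrace; last exact: differentiable_mulmx.
rewrite dd_mulmx// dd_mulmx// mulmxDr !mxtraceD trace_cov; last first.
  by rewrite mulmxA.
rewrite (mxtrace_mulC (A x) (dd u A x *m A x)) -(mulmxA (dd u A x)).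
rewrite (mxtrace_mulC (dd u A x)) (mulmxA (A x) (A x)).
by ring.
Qed.

Let psi2F : (fun y => psi2 (A y)) =
  (fun y => cst 2^-1 y * (tr1 y * tr1 y - tr2 y)).
Proof. by apply/funext => y; rewrite psi2E. Qed.

Let psi3F : (fun y => psi3 (A y)) =
  (fun y => cst 6^-1 y * (tr1 y * (tr1 y * tr1 y)) + cst 3^-1 y * tr3 y
            - cst 2^-1 y * (tr1 y * tr2 y)).
Proof. by apply/funext => y; rewrite psi3E. Qed.

Let dc (a : R) : differentiable (cst a : 'rV[R]_m -> R) x.
Proof. exact: differentiable_cst. Qed.

(** psi2 is a polynomial in the traces of A and A ^+ 2, whose derivatives
    trace_cov provides; the terms collect into the first Newton transformation
    P_1 = (tr A) Id - A, as newton_step requires. *)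
Lemma newton_psi2 :
  differentiable (fun y => psi2 (A y)) x /\
  forall u, dd u (fun y => psi2 (A y)) x =
    \tr (((\tr (A x))%:M - 1%:M *m A x) *m cov g A x u).
Proof.
have d11 := differentiable_fM d1 d1.
have d11_2 := differentiable_fD d11 (differentiable_fN d2).
rewrite psi2F; split=> [|u]; first exact: differentiable_fM.
rewrite dd_fM// dd_cst dd_fD//; last exact: differentiable_fN.
rewrite dd_fN// dd_fM// dtr1 dtr2 mul1mx mulmxBl mul_scalar_mx.
move: (cov g A x u) => D; rewrite mxtraceB mxtraceZ -/(tr1 x) /cst.
by field.
Qed.

(** Likewise with the trace of A ^+ 3; the terms collect into
    P_2 = psi2 Id - P_1 A. *)
Lemma newton_psi3 :
  differentiable (fun y => psi3 (A y)) x /\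
  forall u, dd u (fun y => psi3 (A y)) x =
    \tr (((psi2 (A x))%:M - ((\tr (A x))%:M - 1%:M *m A x) *m A x)
         *m cov g A x u).
Proof.
have d11 := differentiable_fM d1 d1; have d12 := differentiable_fM d1 d2.
have d111 := differentiable_fM d1 d11.
have e1 := differentiable_fM (dc 6^-1) d111.
have e2 := differentiable_fM (dc 3^-1) d3.
have e3 := differentiable_fM (dc 2^-1) d12.
have e12 := differentiable_fD e1 e2.
rewrite psi3F; split=> [|u]; first exact/differentiable_fD/differentiable_fN.
rewrite dd_fD//; last exact: differentiable_fN.
rewrite dd_fN// dd_fD// (dd_fM _ (dc 6^-1))// (dd_fM _ (dc 3^-1))//.
rewrite (dd_fM _ (dc 2^-1))// !dd_cst (dd_fM _ d1 d11) (dd_fM _ d1 d1).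
rewrite (dd_fM _ d1 d2) dtr1 dtr2 dtr3; move: (cov g A x u) => D.
rewrite mul1mx !(mulmxBl, mul_scalar_mx) -scalemxAl !(mxtraceZ, mxtraceB).
rewrite psi2E// -/(tr1 x) -/(tr2 x) /cst.
by field.
Qed.

Let dP1 : differentiable (fun y => (\tr (A y))%:M - 1%:M *m A y) x.
Proof.
apply: differentiable_fD; first exact: differentiable_scalar_mx.
by apply: differentiable_fN; apply: differentiable_mulmx.
Qed.

Let dP2 : differentiable
  (fun y => (psi2 (A y))%:M - ((\tr (A y))%:M - 1%:M *m A y) *m A y) x.
Proof.
have [dpsi2 _] := newton_psi2.
apply: differentiable_fD; first exact: differentiable_scalar_mx.
exact: differentiable_fN (differentiable_mulmx dP1 dA).
Qed.

Lemma differentiable_phi_tensor : differentiable (fun y => phi_tensor (A y)) x.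
Proof.
have [dpsi3 _] := newton_psi3; under eq_fun do rewrite phi_tensorE//.
apply: differentiable_fD; first exact: differentiable_scalar_mx.
exact: differentiable_fN (differentiable_mulmx dP2 dA).
Qed.

Lemma frame_div_phi_tensor : frame_div (g := g) (x := x) (e := e)
  (fun y => phi_tensor (A y)) = 0.
Proof.
have [dpsi2 ddpsi2] := newton_psi2; have [dpsi3 ddpsi3] := newton_psi3.
have step := newton_step gU Ux dA covA_codazzi covA_selfadjoint e_orth.
have dId : differentiable (fun=> 1%:M : 'M[R]_m) x.
  exact: differentiable_cst.
under eq_fun do rewrite phi_tensorE//.
apply: (step _ _ dP2 dpsi3 ddpsi3); apply: (step _ _ dP1 dpsi2 ddpsi2).
apply: (step _ _ dId d1) => [u|]; first by rewrite dtr1 mul1mx.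
rewrite /frame_div big1// => i _.
by rewrite (@cov_scalar _ _ _ _ (cst 1))// dd_cst raddf0 mulmx0.
Qed.

End NewtonTensor.

(** * Charts of the two manifolds *)

Lemma smooth_on_sub (R : realType) (V W : normedModType R) (U O : set V)
    (f : V -> W) : U `<=` O -> smooth_on O f -> smooth_on U f.
Proof.
move=> UO sf k; elim: k f {sf}(sf k) => [|k IH] f /=.
  by move=> cf x /UO; exact: cf.
by move=> [df Cf]; split=> [x /UO/df//|v]; exact/IH/Cf.
Qed.

Lemma open_local_dom (R : realType) (m n : nat) (M : riemannian R m)
    (N : riemannian R n) (phi : M -> N) (k : chart R m M) (l : chart R n N) :
  continuous phi -> open (local_dom phi k l).
Proof.
move=> cphi; rewrite openE => y [ky ly]; apply: filterI.
  by apply: open_nbhs_nbhs; split => //; exact: chart_open_im.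
have ck : {for y, continuous (phi \o cinv k)}.
  by apply: continuous_comp; [exact: chart_cont_inv|exact: cphi].
apply: ck; apply: open_nbhs_nbhs; split => //; exact: chart_open_dom.
Qed.

Lemma metric_on_chart (R : realType) (n : nat) (N : riemannian R n)
    (l : chart R n N) : atlas l -> metric_on (cim l) (metric l).
Proof.
move=> al; split; first exact: chart_open_im.
- exact: metric_smooth.
- exact: (Defs.metric_sym al).
- exact: (Defs.metric_pos al).
Qed.

Theorem lemma3p4 (R : realType) (m : nat) (hm : (2 <= m)%N) (c : R)
  (M : riemannian R m) (N : riemannian R m.+1) (hN : space_form N c)
  (phi : M -> N) (hphi : isometric_immersion phi)
  (eta : chart R m.+1 N -> M -> 'rV[R]_m.+1) (heta : unit_normal phi eta)
  (A : chart R m M -> 'rV[R]_m -> 'M[R]_m) (hA : shape_operator phi eta A) :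
  forall k : chart R m M, atlas k ->
  forall (W : set 'rV[R]_m) (E : 'I_m -> 'rV[R]_m -> 'rV[R]_m),
    open W -> W `<=` cim k -> orthonormal_frame (metric k) W E ->
  forall x, W x -> divT (metric k) (fun y => phi_tensor (A k y)) E x = 0.
Proof.
move=> k ak W E oW Wk [sE oE] x Wx.
have kx := Wk x Wx.
have [l al lx] := mfd_cover (phi (cinv k x)).
pose U := local_dom phi k l; pose F := local_map phi k l.
have Ux : U x by [].
have [cphi /(_ k l ak al)[sF isoF]] := hphi.
have Uk : U `<=` cim k by move=> y [].
have gU : metric_on U (metric k).
  have [_ sg symg posg] := metric_on_chart ak.
  split; first exact: open_local_dom.
  - exact: smooth_on_sub sg.
  - by move=> y /Uk/symg.
  - by move=> y /Uk/posg.
have hO := metric_on_chart al.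
have FO y : U y -> cim l (F y) by move=> [_ ly]; exists (phi (cinv k y)).
pose nu := eta l \o cinv k.
have snu : smooth_on U nu by exact: normal_smooth heta _ _ ak al.
have iso' y : U y -> forall u v,
    ip (metric k y) u v = ip (metric l (F y)) (dd u F y) (dd v F y).
  by move=> Uy u v; rewrite !ddE isoF.
have orth y : U y -> forall v, ip (metric l (F y)) (dd v F y) (nu y) = 0.
  by move=> Uy v; rewrite ddE; exact: normal_orth heta _ _ ak al _ Uy v.
have wein y : U y -> forall v, dd (v *m A k y) F y =
    - (dd v nu y + nu y *m conn (metric l) (F y) (dd v F y)).
  move=> Uy v; rewrite !ddE (hA k l ak al y Uy v) /nabla_along.
  by rewrite christoffel_formE.
(* Each term of the constant curvature formula contains the product of nu with
   a tangent vector. *)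
have curvN y : U y -> forall u v w, ip (metric l (F y))
    (nu y *m curv (metric l) (F y) (dd u F y) (dd v F y)) (dd w F y) = 0.
  move=> Uy u v w; have [_ /(_ l al _ (FO y Uy)) secN] := hN.
  rewrite (constant_curvature hO (FO y Uy) secN) !orth//.
  by rewrite !mul0r subrr mulr0.
have dA := differentiable_shape gU hO sF snu FO iso' wein Ux.
have cod u v := codazzi gU hO sF snu FO iso' wein curvN u v Ux.
have self u := cov_selfadjoint gU hO sF snu FO iso' orth wein u Ux.
have m0 : (0 < m)%N by exact: leq_trans hm.
rewrite -[RHS](frame_div_phi_tensor m0 gU Ux dA cod self (oE x Wx)).
apply: eq_bigr => i _; apply: nablaTE.
  exact: (differentiable_phi_tensor (g := metric k) m0 dA).
exact: smooth_on_differentiable (sE i) Wx.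
Qed.
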